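(* Let $n\ge3$. For any nonempty Borel set $\Omega\subset\mathbb{S}^{n-1}$ and any $\Omega$-Kakeya set $X$ in $\mathbb{R}^n$ we have $$d_X\ge\frac{6}{11}\,d_\Omega+1.$$
   Context: For a set $E$, $d_E$ denotes its Hausdorff dimension. Given $\Omega\subset\mathbb{S}^{n-1}$, a set $X\subset\mathbb{R}^n$ is called an $\Omega$-Kakeya set if for every $e\in\Omega$ there is a unit segment (line segment of length $1$) oriented along $e$ and contained in $X$. *)

(* Defs.v *)
From HB Require Import structures.
From mathcomp Require Import all_boot all_order all_algebra.
From mathcomp Require Import all_classical all_reals all_analysis.
Set Implicit Arguments.
Unset Strict Implicit.
Unset Printing Implicit Defensive.
Import Order.TTheory GRing.Theory Num.Theory.
Import numFieldNormedType.Exports.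
Local Open Scope classical_set_scope.
Local Open Scope ring_scope.

(* The library's norm on 'rV[R]_n is the sup norm; the sphere, unit length and
   diameters below refer to the Euclidean norm.  Both induce the same topology,
   so Borel sets are taken with respect to the library's one. *)
Definition enorm (R : realType) (n : nat) (x : 'rV[R]_n) : R :=
  Num.sqrt (\sum_(i < n) x ord0 i ^+ 2).

Definition esphere (R : realType) (n : nat) : set 'rV[R]_n :=
  [set x | enorm x = 1].

Definition borel_set (T : topologicalType) (A : set T) : Prop :=
  <<s [set U : set T | open U] >> A.

Definition ediam (R : realType) (n : nat) (A : set 'rV[R]_n) : \bar R :=
  ereal_sup [set (enorm (p.1 - p.2))%:E | p in A `*` A].

(* [poweR x 0 = 1] for every [x], so the empty set is singled out to make the
   0-dimensional measure the counting measure. *)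
Definition ediam_pow (R : realType) (n : nat) (s : R) (A : set 'rV[R]_n) :
    \bar R :=
  if A == set0 then 0%E else poweR (ediam A) s.

Definition hausdorff_pre (R : realType) (n : nat) (s delta : R)
    (A : set 'rV[R]_n) : \bar R :=
  ereal_inf [set (\sum_(0 <= i <oo) ediam_pow s (F i))%E
            | F in [set F : (set 'rV[R]_n)^nat
                   | (forall i, (ediam (F i) <= delta%:E)%E) /\
                     A `<=` \bigcup_i F i]].

Definition hausdorff_measure (R : realType) (n : nat) (s : R)
    (A : set 'rV[R]_n) : \bar R :=
  ereal_sup [set hausdorff_pre s delta A | delta in [set delta : R | 0 < delta]].

Definition hausdorff_dim (R : realType) (n : nat) (A : set 'rV[R]_n) :
    \bar R :=
  ereal_inf [set s%:E | s in [set s : R | 0 <= s /\ hausdorff_measure s A = 0%E]].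

(* For [e] of Euclidean norm 1, the segment of length 1 from [a] along [e]. *)
Definition unit_segment (R : realType) (n : nat) (a e : 'rV[R]_n) :
    set 'rV[R]_n :=
  [set a + t *: e | t in [set t : R | 0 <= t <= 1]].

Definition kakeya_set (R : realType) (n : nat) (Omega X : set 'rV[R]_n) :
    Prop :=
  forall e, Omega e -> exists a, unit_segment a e `<=` X.

(* Main.v *)
(* The bound follows from the stronger 4/7 d_Omega + 1, obtained by slicing, as
   in the arguments of Bourgain and Katz-Tao, but with slices whose existence
   needs no theorem on arithmetic progressions.

   Cover X by pieces of size at most 1/M lying at one scale, and consider lines
   (P, w), that is y |-> P + y w, whose traces at five heights k, a, h, al, ka lie
   in few (at most N) pieces per height.  Take lines l1, l1' meeting a common
   piece at height a, l2, l2' meeting a common piece at height a, l1, l2 at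
   height h, and l1', l2' at height k.  If
       (al - k) (a - k) = (ka - k) (h - k),
   then the pieces of l1 and l1' at height al and of l2' at height ka determine
   the direction of l2 up to an error comparable to 1/M, hence the whole
   quadrilateral once the directions are sufficiently separated.  By
   Cauchy-Schwarz, a set G of lines yields at least |G|^4 / N^4 quadrilaterals,
   hence |G|^4 <= N^7.

   Such heights are found inside sets of heights of density 1/u with a loss
   polynomial in u: average over the geometric progressions k + s c^i, and note
   that i + j = i' + j' has solutions in any set of indices of size larger than
   the square root of the length.  Polynomial losses are affordable with
   M = u^L and L large, so that one may pigeonhole over all the scales
   u = 2^l. *)
Require Import Defs.
From mathcomp Require Import all_boot all_order all_algebra.
From mathcomp Require Import zify ring lra.
Set Implicit Arguments.
Unset Strict Implicit.
Unset Printing Implicit Defensive.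

(** * Counting quadrilaterals and finding common heights *)

Lemma sqr_sum_leq (T : finType) (A : {set T}) (F : T -> nat) :
  (\sum_(i in A) F i) ^ 2 <= #|A| * \sum_(i in A) F i ^ 2.
Proof.
rewrite -(@leq_pmul2l 2)// expnS expn1 big_distrlr /=.
have -> : 2 * (#|A| * \sum_(i in A) F i ^ 2) =
    \sum_(i in A) \sum_(j in A) (F i ^ 2 + F j ^ 2).
  transitivity (\sum_(i in A) (#|A| * F i ^ 2 + \sum_(j in A) F j ^ 2)).
    by rewrite big_split /= -big_distrr /= sum_nat_const mul2n addnn.
  by apply: eq_bigr => i _; rewrite /= big_split /= sum_nat_const.
rewrite big_distrr /=; apply: leq_sum => i _.
rewrite big_distrr /=; apply: leq_sum => j _; exact: nat_Cauchy.
Qed.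

(** Cauchy-Schwarz over the fibres of [f]: their sizes add up to [#|A|], and the squares of their
    sizes to the number of colliding pairs. *)
Lemma card_collisions (T U : finType) (f : T -> U) (A : {set T}) :
  #|A| ^ 2 <= #|f @: A| * #|[set p in setX A A | f p.1 == f p.2]|.
Proof.
have fib (F : T -> nat) : \sum_(x in A) F x =
    \sum_(y in f @: A) \sum_(x in A | f x == y) F x.
  by apply: (partition_big f) => x xA; apply: imset_f.
rewrite -[in X in X ^ 2]sum1_card fib.
apply: leq_trans (sqr_sum_leq _ _) _; rewrite leq_mul2l; apply/orP; right.
rewrite -sum1_card (eq_bigl (fun p : T * T => (p.1 \in A) && ((p.2 \in A) && (f p.2 == f p.1)))).
  rewrite -(pair_big_dep (fun x => x \in A) (fun x y => (y \in A) && (f y == f x)) (fun _ _ => 1)) /=.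
  rewrite fib; apply/eq_leq/eq_bigr => y _.
  rewrite expnS expn1 big_distrl /=; apply: eq_bigr => x /andP[xA /eqP <-].
  by rewrite mul1n.
by move=> [x y]; rewrite !inE /= andbA eq_sym.
Qed.

(** Let [V] be the pairs meeting at height a and [W] the pairs of members of [V] that also meet at
    heights h and k. Two applications of [card_collisions] give |G|^4 <= N^2 |V|^2 <= N^4 |W|, and
    the last hypothesis makes a triple of labels injective on [W], so that |W| <= N^3. *)
Lemma quadrilateral_count (D J : finType) (G : {set D}) (N : nat)
    (fa fh fk g1 g2 : D -> J) :
  #|fa @: G| <= N -> #|fh @: G| <= N -> #|fk @: G| <= N ->
  #|g1 @: G| <= N -> #|g2 @: G| <= N ->
  (forall x x' y y' z z' t t' : D,
     x \in G -> x' \in G -> y \in G -> y' \in G ->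
     z \in G -> z' \in G -> t \in G -> t' \in G ->
     fa x = fa x' -> fa y = fa y' -> fh x = fh y -> fk x' = fk y' ->
     fa z = fa z' -> fa t = fa t' -> fh z = fh t -> fk z' = fk t' ->
     g1 x = g1 z -> g1 x' = g1 z' -> g2 y' = g2 t' ->
     [/\ x = z, x' = z', y = t & y' = t']) ->
  #|G| ^ 4 <= N ^ 7.
Proof.
move=> Na Nh Nk N1 N2 inj.
pose V := [set p in setX G G | fa p.1 == fa p.2].
have GV : #|G| ^ 2 <= N * #|V|.
  by apply: leq_trans (card_collisions fa G) _; rewrite leq_mul2r Na orbT.
pose phi (p : D * D) := (fh p.1, fk p.2).
pose W := [set p in setX V V | phi p.1 == phi p.2].
have VW : #|V| ^ 2 <= N ^ 2 * #|W|.
  apply: leq_trans (card_collisions phi V) _; rewrite leq_mul2r; apply/orP; right.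
  apply: leq_trans (_ : #|setX (fh @: G) (fk @: G)| <= _).
    apply/subset_leq_card/subsetP => _ /imsetP[[x y] + ->].
    by rewrite !inE /= => /andP[/andP[? ?] _]; rewrite !imset_f.
  by rewrite cardsX expnS expn1 leq_mul.
have WN : #|W| <= N ^ 3.
  pose psi (q : (D * D) * (D * D)) := (g1 q.1.1, g1 q.1.2, g2 q.2.2).
  rewrite -(@card_in_imset _ _ psi W); last first.
    move=> [[x x'] [y y']] [[z z'] [t t']]; rewrite !inE /= /phi /=.
    case/andP=> /andP[/andP[/andP[xG x'G] /eqP ex] /andP[/andP[yG y'G] /eqP ey]].
    case/eqP=> eh ek.
    case/andP=> /andP[/andP[/andP[zG z'G] /eqP ez] /andP[/andP[tG t'G] /eqP et]].
    case/eqP=> eh' ek' [e1 e2 e3].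
    by have [-> -> -> ->] := inj x x' y y' z z' t t' xG x'G yG y'G zG z'G tG t'G
        ex ey eh ek ez et eh' ek' e1 e2 e3.
  apply: leq_trans (_ : #|setX (setX (g1 @: G) (g1 @: G)) (g2 @: G)| <= _).
    apply/subset_leq_card/subsetP => _ /imsetP[[[x x'] [y y']] + ->].
    rewrite !inE /= => /andP[/andP[/andP[/andP[? ?] _] /andP[/andP[? ?] _]] _].
    by rewrite !imset_f.
  by rewrite !cardsX !expnS expn0 muln1 mulnA !leq_mul.
have : #|G| ^ 4 <= N ^ 2 * #|V| ^ 2.
  by rewrite -expnMn (expnM _ 2 2) leq_exp2r.
move=> /leq_trans; apply.
rewrite (_ : N ^ 7 = N ^ 2 * (N ^ 2 * N ^ 3)) ?leq_mul2l; last by rewrite -!expnD.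
by apply/orP; right; apply: leq_trans VW _; rewrite leq_mul2l WN orbT.
Qed.

Lemma leq_avg_exists (T : finType) (F : T -> nat) (c : nat) :
  0 < #|T| -> c <= \sum_t F t -> exists t, c <= #|T| * F t.
Proof.
move=> T0 cF; apply/existsP; apply: contraT; rewrite negb_exists => /forallP lt.
have [t0 _] : exists t0 : T, true by case/card_gt0P: T0 => t0 _; exists t0.
have c0 : 0 < c by move: (lt t0); rewrite -ltnNge; apply: leq_ltn_trans.
have : #|T| * \sum_t F t <= #|T| * c.-1.
  rewrite big_distrr /= -sum_nat_const; apply: leq_sum => t _.
  by move: (lt t); rewrite -ltnNge; move: (_ * _) => y; lia.
by rewrite leq_pmul2l// => /(leq_trans cF); lia.
Qed.

(* [s c^i] rounded down, for c = 1 - 1/(2K), so that c^i >= 1/2 for i <= K. *)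
Definition geo (K s i : nat) : nat := (s * (2 * K - 1) ^ i) %/ (2 * K) ^ i.

(** Bernoulli's inequality (1 - 1/(2K))^i >= 1 - i/(2K), with denominators cleared. *)
Lemma geo_bernoulli (K i : nat) : 0 < K -> i <= K ->
  (2 * K - i) * (2 * K) ^ i <= 2 * K * (2 * K - 1) ^ i.
Proof.
move=> K0; elim: i => [|i IH] iK; first by rewrite !expn0; lia.
have := IH (ltnW iK); rewrite !expnS.
move: (_ ^ i) => B; move: (_ ^ i) => A {}IH.
have h : (2 * K - i.+1) * (2 * K) <= (2 * K - i) * (2 * K - 1) by nia.
apply: (@leq_trans ((2 * K - i) * (2 * K - 1) * B)).
  by rewrite mulnA leq_mul2r h orbT.
by rewrite mulnAC (mulnC (2 * K - 1) A) (mulnA (2 * K) A) leq_mul2r IH orbT.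
Qed.

Lemma geo_half (K i : nat) : 0 < K -> i <= K ->
  (2 * K) ^ i <= 2 * (2 * K - 1) ^ i.
Proof.
move=> K0 iK; rewrite -(leq_pmul2l K0); apply: leq_trans (_ : 2 * K * (2 * K - 1) ^ i <= _).
  apply: leq_trans (geo_bernoulli K0 iK); rewrite leq_mul2r; apply/orP; right; lia.
by rewrite mulnA (mulnC K).
Qed.

(** The quotient of x by (1 - 1/(2K))^i rounded up, that is, the least [s] for which [geo K s i]
    reaches [x]. *)
Definition geo_inv (K i x : nat) : nat :=
  (x * (2 * K) ^ i + ((2 * K - 1) ^ i).-1) %/ (2 * K - 1) ^ i.

Lemma geo_invP (K i x : nat) : 0 < K -> i <= K ->
  geo K (geo_inv K i x) i = x /\ x <= geo_inv K i x <= 2 * x + 1.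
Proof.
move=> K0 iK.
have A0 : 0 < (2 * K - 1) ^ i by rewrite expn_gt0; apply/orP; left; lia.
have AB : (2 * K - 1) ^ i <= (2 * K) ^ i.
  by case: (posnP i) => [->//|i0]; rewrite leq_exp2r//; lia.
have BA := geo_half K0 iK.
rewrite /geo /geo_inv; move: (_ ^ i) A0 AB BA => A A0; move: (_ ^ i) => B AB BA.
split; last first.
  rewrite leq_divRL//; apply/andP; split; first by nia.
  rewrite -ltnS ltn_divLR//; nia.
have h := divn_eq (x * B + A.-1) A.
have h2 := ltn_pmod (x * B + A.-1) A0.
apply/eqP; rewrite eqn_leq; apply/andP; split.
  by rewrite -ltnS ltn_divLR; nia.
by rewrite leq_divRL; nia.
Qed.

(** Each first member has at most [2 * s0] second members closer than [s0], and a swap matches the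
    two orders of the remaining pairs. With t = [#|T|] this gives 2 |P| >= t (t - 2 s0) >= 8
    s0^2. *)
Lemma distant_pairs (M s0 : nat) (T : {set 'I_M}) : 4 * s0 <= #|T| ->
  4 * s0 ^ 2 <= #|[set p in setX T T | p.1 + s0 <= p.2]|.
Proof.
move=> hT; set P := [set p in _ | _].
pose near := [set p in setX T T | (p.1 < p.2 + s0) && (p.2 < p.1 + s0)].
have near_le : #|near| <= #|T| * (2 * s0).
  case: (posnP s0) => [s00|s0_gt0].
    rewrite (_ : near = set0) ?cards0//; apply/setP => -[x y].
    rewrite !inE /= s00; lia.
  pose r := (2 * s0).-1; have r2 : 2 * s0 = r.+1 by rewrite /r; lia.
  pose g (p : 'I_M * 'I_M) := (p.1, @inord r (p.2 + s0 - p.1)).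
  rewrite r2 -(@card_in_imset _ _ g near); last first.
    move=> [x y] [z t]; rewrite !inE /= => /andP[_ /andP[h1 h2]] /andP[_ /andP[h3 h4]].
    case=> e; rewrite -{}e in h3 h4 *; move/(congr1 val).
    rewrite /= !inordK; [|lia|lia] => e.
    by congr (_, _); apply/val_inj => /=; lia.
  rewrite -[X in _ * X]card_ord.
  rewrite -[X in _ * X]cardsT -cardsX; apply/subset_leq_card/subsetP => _ /imsetP[[x y] + ->].
  by rewrite !inE /= => /andP[/andP[-> _] _].
pose sw (p : 'I_M * 'I_M) := (p.2, p.1).
have sub : setX T T \subset P :|: sw @: P :|: near.
  apply/subsetP => -[x y]; rewrite !inE /= => /andP[xT yT].
  rewrite xT yT /=; case: (leqP (x + s0) y) => //= h1.
  case: (leqP (y + s0) x) => [h2|h2]; last by rewrite orbT.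
  apply/orP; left; apply/imsetP; exists (y, x) => //.
  by rewrite !inE /= xT yT.
have := leq_trans (subset_leq_card sub) (leq_card_setU _ _).
move=> /leq_trans/(_ (leq_add (leq_card_setU _ _) near_le)).
rewrite cardsX => h; have := leq_imset_card sw P => h'.
have {h h'} : #|T| * #|T| <= #|P| + #|P| + #|T| * (2 * s0).
  by apply: leq_trans h _; rewrite leq_add2r leq_add2l.
move: #|T| #|P| hT => t p; rewrite expnS expn1 => h1 h2.
have : 4 * s0 * (t - 2 * s0) <= t * (t - 2 * s0) by rewrite leq_mul2r h1 orbT.
rewrite !mulnBr; nia.
Qed.

(** Pigeonhole: there are about [#|I| ^ 2 / 2] increasing pairs, but at most [2 * K + 1] values for
    their sums. *)
Lemma sum_coincidence (K : nat) (I : {set 'I_K}) : 0 < K -> 16 * K <= #|I| ^ 2 ->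
  exists i j i' j', [/\ i \in I, j \in I, i' \in I & j' \in I] /\
    [/\ (i < j)%N, (i' < j')%N, i + j = i' + j' & i != i'].
Proof.
move=> K0 hI; pose L := [set p in setX I I | p.1 < p.2].
pose sw (p : 'I_K * 'I_K) := (p.2, p.1).
have IL : #|I| ^ 2 <= #|L| + #|L| + #|I|.
  have sub : setX I I \subset L :|: sw @: L :|: (fun i => (i, i)) @: I.
    apply/subsetP => -[x y]; rewrite !inE /= => /andP[xT yT].
    rewrite xT yT /=; case: ltngtP => //= h.
      apply/orP; left; apply/imsetP; exists (y, x) => //.
      by rewrite !inE /= xT yT.
    by apply/orP; right; apply/imsetP; exists x => //; congr (_, _); apply/val_inj.
  rewrite expnS expn1 -cardsX; apply: leq_trans (subset_leq_card sub) _.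
  apply: leq_trans (leq_card_setU _ _) _; apply: leq_add (leq_imset_card _ _).
  by apply: leq_trans (leq_card_setU _ _) _; rewrite leq_add2l leq_imset_card.
pose f (p : 'I_K * 'I_K) := @inord (2 * K) (p.1 + p.2).
have [/dinjectiveP|/dinjectivePn] := boolP (dinjectiveb f (mem L)).
  move=> /card_in_imset fL; have := max_card (mem (f @: L)).
  rewrite fL card_ord; move: #|L| #|I| hI IL => l y; rewrite expnS expn1 => h1 h2 h3.
  have y4 : 4 <= y by rewrite leqNgt; apply/negP => y4; have := leq_mul y4 y4; nia.
  have : 4 * y <= y * y by rewrite leq_mul2r y4 orbT.
  lia.
case=> -[i j] ijL [[i' j']]; rewrite !inE /= => /andP[ne].
move: ijL; rewrite !inE /= => /andP[/andP[iI jI] ij] /andP[/andP[i'I j'I] ij'].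
have lt2 (x y : 'I_K) : x + y < (2 * K).+1.
  by rewrite ltnS mul2n -addnn leq_add // ltnW.
move/(congr1 val); rewrite /= !inordK ?lt2// => e.
exists i, j, i', j'; split=> //; split=> //.
apply: contra ne => /eqP ii; rewrite ii; apply/eqP; congr (_, _).
by move: e; rewrite ii => /addnI /val_inj.
Qed.

(** Two averagings: over the start [k] and the size [s] of the progression [k + geo K s i], then
    over the [K ^ 4] quadruples of indices. The choice [K = 16 * c ^ 2] makes any set of at least K
    / c indices large enough for [sum_coincidence]. *)
Lemma common_heights (D : finType) (T : D -> nat -> bool) (u s0 : nat) :
  let c := 96 * u ^ 2 in let K := 16 * c ^ 2 in let M := 8 * u * s0 in
  0 < u -> 0 < s0 -> 0 < #|D| ->
  (forall e, M <= 2 * u * #|[set x : 'I_M | T e x]|) ->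
  exists k s al a ka h, exists G : {set D},
    [/\ [/\ k < M, s0 <= s & s <= 2 * M],
        [/\ al < a, a < K, ka < h & h < K],
        al + a = ka + h /\ al != ka,
        #|D| <= c * K ^ 4 * #|G| &
        forall e, e \in G -> T e k /\
         {in [:: al; a; ka; h], forall i, k + geo K s i < M /\ T e (k + geo K s i)}].
Proof.
move=> c K M u0 s00 D0 hT.
have c0 : 0 < c by rewrite /c muln_gt0 expn_gt0 u0.
have K0 : 0 < K by rewrite /K muln_gt0 expn_gt0 c0.
have M0 : 0 < M by rewrite /M !muln_gt0 u0 s00.
pose S := ('I_M * 'I_(2 * M).+1)%type.
pose W e (i : 'I_K) (p : S) := [&& T e p.1, p.1 + geo K p.2 i < M,
  T e (p.1 + geo K p.2 i) & s0 <= p.2].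
(* Points x and y of [T e] with [x + s0 <= y] are reached by [k = x] and [s = geo_inv K i (y - x)],
   so distant pairs inject into the admissible pairs (k, s). *)
have cardW e i : 4 * s0 ^ 2 <= #|[set p | W e i p]|.
  have hTe : 4 * s0 <= #|[set x : 'I_M | T e x]|.
    have := hT e; rewrite /M; move: #|_| => n.
    by rewrite (_ : 8 * u * s0 = 2 * u * (4 * s0)) ?leq_pmul2l ?muln_gt0//; lia.
  apply: leq_trans (distant_pairs hTe) _; set P := [set p in _ | _].
  have inv x := geo_invP x K0 (ltnW (ltn_ord i)).
  pose g (p : 'I_M * 'I_M) : S := (p.1, inord (geo_inv K i (p.2 - p.1))).
  have gE (p : 'I_M * 'I_M) : ((g p).2 : nat) = geo_inv K i (p.2 - p.1).
    rewrite /= inordK//; have [_ /andP[_]] := inv (p.2 - p.1).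
    have := ltn_ord p.2; lia.
  rewrite -(@card_in_imset _ _ g P); last first.
    move=> [x y] [x' y']; rewrite !inE /= => /andP[_ h1] /andP[_ h2] eg.
    have /(congr1 (geo K ^~ i)) := congr1 (fun p : S => nat_of_ord p.2) eg.
    rewrite !gE !(inv _).1 /= => h; have ex : x = x' by case: eg.
    rewrite -{}ex {eg} in h h2 *; congr (_, _).
    by apply: val_inj => /=; move: h h1 h2; clear; lia.
  apply/subset_leq_card/subsetP => _ /imsetP[[x y] + ->].
  rewrite !inE /= => /andP[/andP[hx hy] xy].
  rewrite /W gE /= (inv _).1 subnKC; last by lia.
  by rewrite hx hy ltn_ord /=; have [_ /andP[+ _]] := inv (y - x); lia.
pose I (p : S) e := [set i | W e i p].
have tot : #|D| * (K * (4 * s0 ^ 2)) <= \sum_(p : S) \sum_e #|I p e|.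
  rewrite exchange_big /= -[X in X <= _]sum_nat_const; apply: leq_sum => e _.
  rewrite -{1}[K]card_ord -sum_nat_const.
  have -> : \sum_(p : S) #|I p e| = \sum_(i < K) #|[set p | W e i p]|.
    under eq_bigr => p _ do rewrite -sum1dep_card big_mkcond /=.
    rewrite exchange_big /=; apply: eq_bigr => i _.
    by rewrite -big_mkcond /= sum1dep_card.
  by apply: leq_sum => i _; exact: cardW.
have [[k s]] : exists p : S, #|D| * K <= 48 * u ^ 2 * \sum_e #|I p e|.
  have S0 : 0 < #|{: S}| by rewrite card_prod !card_ord muln_gt0 M0.
  have [p hp] := leq_avg_exists S0 tot; exists p.
  rewrite -(@leq_pmul2r (4 * s0 ^ 2)) ?muln_gt0 ?expn_gt0 ?s00// -mulnA.
  apply: leq_trans hp _; rewrite card_prod !card_ord.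
  (* Here 3 M^2 = 192 u^2 s0^2, whence the factor 48; [c] is twice [48 * u ^ 2] to pay for the
     restriction to [G0]. *)
  have MM : M * (2 * M).+1 <= 48 * u ^ 2 * (4 * s0 ^ 2).
    apply: (@leq_trans (M * (3 * M))).
      by rewrite leq_mul2l; apply/orP; right; move: (M) M0 => m; clear; lia.
    by rewrite /M (_ : _ * (3 * _) = 48 * u ^ 2 * (4 * s0 ^ 2))// !expnS !expn0; lia.
  by rewrite [X in _ <= X]mulnAC leq_mul2r MM orbT.
move=> /= hks.
(* Lines with at least K / c good indices in the chosen progression. The other lines account for at
   most half of the total, so [G0] keeps a proportion 1 / c of all lines. *)
pose G0 := [set e | K <= c * #|I (k, s) e|].
have hG0 : #|D| <= c * #|G0|.
  have h1 : \sum_e c * #|I (k, s) e| <= \sum_(e in G0) c * K + \sum_(e in ~: G0) K.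
    rewrite (bigID (mem G0)) /=; apply: leq_add.
      apply: leq_sum => e _; rewrite leq_mul2l; apply/orP; right.
      by rewrite -[X in _ <= X]card_ord max_card.
    rewrite [X in _ <= X](eq_bigl (fun e => e \notin G0)); last by move=> e; rewrite inE.
    by apply: leq_sum => e; rewrite inE -ltnNge => /ltnW.
  rewrite !sum_nat_const -big_distrr /= in h1.
  have h2 : #|~: G0| <= #|D| by exact: max_card.
  rewrite -(leq_pmul2r K0).
  have := leq_trans h1 (leq_add (leqnn _) (leq_mul h2 (leqnn K))).
  have : 2 * (#|D| * K) <= c * \sum_e #|I (k, s) e|.
    have -> : c = 2 * (48 * u ^ 2) by rewrite mulnA.
    by rewrite -mulnA leq_pmul2l.
  rewrite -mulnA; set F := \sum_e _; move: (c * F) (#|D| * K) => cF DK.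
  by rewrite mulnCA; move: (c * _) => y; clear; lia.
pose S4 := ('I_K * 'I_K * 'I_K * 'I_K)%type.
pose good e (q : S4) := let: (al, a, ka, h) := q in
  [&& al \in I (k, s) e, a \in I (k, s) e, ka \in I (k, s) e, h \in I (k, s) e, al < a, ka < h,
  al + a == ka + h & al != ka].
have goodE e : e \in G0 -> exists q, good e q.
  rewrite inE => he; case: (@sum_coincidence K (I (k, s) e) K0).
    rewrite (_ : 16 * K = (16 * c) ^ 2); last by rewrite expnMn -mulnA.
    by rewrite leq_exp2r// -(leq_pmul2l c0) (_ : c * _ = K)// mulnCA.
  move=> al [a [ka [h [[h1 h2 h3 h4] [h5 h6 h7 h8]]]]].
  by exists (al, a, ka, h); rewrite /good h1 h2 h3 h4 h5 h6 h7 h8 eqxx.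
have tot4 : #|G0| <= \sum_q #|[set e in G0 | good e q]|.
  under eq_bigr => q _ do rewrite -sum1dep_card big_mkcond /=.
  rewrite exchange_big /= -sum1_card big_mkcond /=; apply: leq_sum => e _.
  case: ifP => // /goodE[q hq]; rewrite (bigD1 q)//= hq.
  by rewrite ?inE ?eqxx.
have S4c : #|{: S4}| = K ^ 4.
  by rewrite !card_prod !card_ord !expnS expn0 muln1 !mulnA.
have S40 : 0 < #|{: S4}| by rewrite S4c expn_gt0 K0.
have [[[[al a] ka] h]] := leq_avg_exists S40 tot4.
set G := [set e in G0 | _] => hG.
have {hG} hG : #|D| <= c * K ^ 4 * #|G|.
  by apply: leq_trans hG0 _; rewrite -mulnA leq_mul2l -S4c hG orbT.
exists k, s, al, a, ka, h, G.
have mem_G e : e \in G -> good e (al, a, ka, h) by rewrite inE => /andP[].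
have [e eG] : exists e, e \in G.
  apply/card_gt0P; move: (leq_trans D0 hG); rewrite lt0n muln_eq0 negb_or => /andP[_].
  by rewrite -lt0n.
have := mem_G e eG; rewrite /good /I !inE /W /=.
case/andP=> /and4P[_ _ _ hs] /and4P[_ _ _ /and4P[lt1 lt2 /eqP e1 e2]].
split=> //.
  by split=> //; rewrite -ltnS.
move=> x /mem_G; rewrite /good /I !inE /W /=.
case/and4P=> /and4P[tk m1 t1 _] /and4P[_ m2 t2 _] /and4P[_ m3 t3 _].
case/andP=> /and4P[_ m4 t4 _] _; split=> // i.
by rewrite !inE => /or4P[] /eqP ->.
Qed.

(** * Lines, heights and the size of a direction-separated family *)

Import Order.TTheory GRing.Theory Num.Theory.
Local Open Scope ring_scope.

(* Differences of two quadrilaterals, one coordinate at a time, with heights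
   relative to k: if the seven quantities bounded by E vanish, then
   al (h - a) w2 = (h ka - al a) w2'. *)
Lemma quadrilateral_estimate (R : realFieldType) (al a ka h sg E eta : R)
    (p1 w1 p1' w1' p2 w2 p2' w2' : R) :
  0 < sg -> sg <= al -> al <= 1 -> 0 <= h <= 1 ->
  sg <= `|a - al| -> sg <= `|h - a| -> sg <= 1 ->
  `|h * ka - al * a| <= eta -> `|w2'| <= 2 ->
  `|p1 + al * w1| <= E -> `|p1' + al * w1'| <= E -> `|p2' + ka * w2'| <= E ->
  `|(p1 + a * w1) - (p1' + a * w1')| <= E ->
  `|(p2 + a * w2) - (p2' + a * w2')| <= E ->
  `|(p1 + h * w1) - (p2 + h * w2)| <= E ->
  `|p1' - p2'| <= E ->
  sg ^+ 3 * `|w2| <= 10 * E + 2 * eta.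
Proof.
move=> sg0 sal al1 /andP[h0 h1] sa sh sg1 heta hw.
set s1 := p1 + al * w1; set s2 := p1' + _; set s3 := p2' + ka * _.
set s4 := (_ - _ : R); set s5 := (p2 + a * w2 - _); set s6 := (p1 + h * w1 - _).
set s7 := p1' - p2'; move=> e1 e2 e3 e4 e5 e6 e7.
have E0 : 0 <= E by apply: le_trans e1.
have aal : a - al != 0.
  by rewrite -normr_eq0 gt_eqF// (lt_le_trans sg0).
(* Since [s4 - s1 + s2] equals [(a - al) * (w1 - w1')], the relation is multiplied by [a - al],
   which avoids a division. *)
have id : al * (h - a) * w2 * (a - al) =
    (al * (s1 - s6 - s5 - s3) + (h - al) * (s2 - s7 - s3) +
      (h * ka - al * a) * w2') * (a - al) + al * (h - al) * (s4 - s1 + s2).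
  by rewrite /s1 /s2 /s3 /s4 /s5 /s6 /s7; ring.
have hal : `|h - al| <= 1 by rewrite ler_norml; apply/andP; split; lra.
have al0 : 0 <= al by lra.
have nal : `|al| <= 1 by rewrite ger0_norm.
have b1 : `|al * (s1 - s6 - s5 - s3)| <= 4 * E.
  rewrite normrM -[4 * E]mul1r ler_pM//.
  have : `|s1 - s6 - s5 - s3| <= `|s1| + `|s6| + `|s5| + `|s3|.
    by rewrite (le_trans (ler_normB _ _))// lerD2r (le_trans (ler_normB _ _))// lerD2r ler_normB.
  by move: e1 e3 e5 e6; lra.
have b2 : `|(h - al) * (s2 - s7 - s3)| <= 3 * E.
  rewrite normrM -[3 * E]mul1r ler_pM//.
  have : `|s2 - s7 - s3| <= `|s2| + `|s7| + `|s3|.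
    by rewrite (le_trans (ler_normB _ _))// lerD2r ler_normB.
  by move: e2 e3 e7; lra.
have b3 : `|(h * ka - al * a) * w2'| <= eta * 2 by rewrite normrM ler_pM.
have b4 : `|al * (h - al) * (s4 - s1 + s2)| <= 3 * E.
  have n1 : `|al * (h - al)| <= 1 by rewrite normrM -[leRHS]mul1r ler_pM.
  rewrite normrM -[3 * E]mul1r ler_pM//.
  have : `|s4 - s1 + s2| <= `|s4| + `|s1| + `|s2|.
    by rewrite (le_trans (ler_normD _ _))// lerD2r ler_normB.
  by move: e1 e2 e4; lra.
move: id => /(congr1 Num.norm); rewrite normrM => id.
set X := (_ + _ + _ in RHS) in id.
have bX : `|X| <= 7 * E + eta * 2.
  have : `|X| <= `|al * (s1 - s6 - s5 - s3)| + `|(h - al) * (s2 - s7 - s3)| + `|(h * ka - al * a) * w2'|.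
    by rewrite (le_trans (ler_normD _ _))// lerD2r ler_normD.
  by move: b1 b2 b3; lra.
have eta0 : 0 <= eta by apply: le_trans heta.
have step : `|al * (h - a) * w2| * `|a - al| <= (7 * E + eta * 2) * `|a - al| + 3 * E.
  rewrite id (le_trans (ler_normD _ _))// lerD// normrM ler_wpM2r//.
have {}step : `|al * (h - a) * w2| * sg <= (7 * E + eta * 2) * sg + 3 * E.
  set x := `|_ * w2| in step *; set y := `|a - al| in step sa *.
  have [lt|ge] := leP x (7 * E + eta * 2).
    by apply: le_trans (_ : (7 * E + eta * 2) * sg <= _); nra.
  nra.
have : sg * sg * `|w2| <= `|al * (h - a) * w2|.
  by rewrite !normrM ler_wpM2r// ler_pM// ?(ltW sg0)// ger0_norm.
rewrite !exprS expr0 mulr1; set x := `|_ * w2| in step *; set z := `|w2|.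
have : (7 * E + eta * 2) * sg <= 7 * E + eta * 2 by nra.
nra.
Qed.

Lemma geo_bounds (R : realFieldType) (K s i : nat) : (0 < K)%N ->
  (geo K s i)%:R <= s%:R * ((2 * K - 1)%:R / (2 * K)%:R) ^+ i :> R /\
  s%:R * ((2 * K - 1)%:R / (2 * K)%:R) ^+ i < (geo K s i)%:R + 1 :> R.
Proof.
move=> K0; have B0 : (0 < (2 * K) ^ i)%N by rewrite expn_gt0 muln_gt0 K0.
rewrite expr_div_n mulrA -!natrX -natrM; split.
  by rewrite ler_pdivlMr ?ltr0n// -natrM ler_nat leq_trunc_div.
by rewrite ltr_pdivrMr ?ltr0n// natr1 -natrM ltr_nat ltn_ceil.
Qed.

Lemma geo_ratio_half (R : realFieldType) (K i : nat) : (0 < K)%N -> (i <= K)%N ->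
  2^-1 <= ((2 * K - 1)%:R / (2 * K)%:R) ^+ i :> R.
Proof.
move=> K0 iK; have B0 : (0 < (2 * K) ^ i)%N by rewrite expn_gt0 muln_gt0 K0.
rewrite expr_div_n -!natrX ler_pdivlMr ?ltr0n// mulrC ler_pdivrMr// -natrM ler_nat.
by rewrite [leqRHS]mulnC geo_half.
Qed.

(** With q = 1 - 1/(2K), one has q^i - q^j >= q^i (1 - q) >= 1/(4K). Multiplied by [s] this exceeds
    twice the claimed gap, and the rounding error, at most 1, is bounded by [s0 / (8 * K)]. *)
Lemma geo_gap (R : realFieldType) (K s0 s i j : nat) : (0 < K)%N ->
  (8 * K <= s0)%N -> (s0 <= s)%N -> (i < j)%N -> (j <= K)%N ->
  s0%:R / (8 * K)%:R <= (geo K s i)%:R - (geo K s j)%:R :> R.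
Proof.
move=> K0 Ks0 s0s ij jK.
have [_ hi] := geo_bounds R s i K0; have [hj _] := geo_bounds R s j K0.
have hh := geo_ratio_half R K0 (leq_trans (ltnW ij) jK).
have K0R : 0 < K%:R :> R by rewrite ltr0n.
set q := _ / _ in hi hj hh.
have q1 : 1 - q = (2 * K%:R)^-1.
  by rewrite /q natrB ?muln_gt0// natrM; field; rewrite gt_eqF.
have q01 : 0 <= q <= 1.
  apply/andP; split; first by rewrite /q divr_ge0.
  by rewrite -subr_ge0 q1 invr_ge0; nra.
have gap : (4 * K%:R)^-1 <= q ^+ i - q ^+ j.
  apply: (@le_trans _ _ (q ^+ i * (1 - q))).
    rewrite q1 (_ : (4 * K%:R)^-1 = 2^-1 * (2 * K%:R)^-1).
      by rewrite ler_wpM2r// invr_ge0; nra.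
    by field; rewrite gt_eqF.
  rewrite mulrBr mulr1 lerB// -exprSr; case/andP: q01 => ? ?; exact: ler_wiXn2l.
have s0R : s0%:R <= s%:R :> R by rewrite ler_nat.
have KR : (8 * K)%:R <= s0%:R :> R by rewrite ler_nat.
have : 1 <= s0%:R / (8 * K)%:R :> R.
  by rewrite ler_pdivlMr ?mul1r// ltr0n muln_gt0 K0.
have e : s0%:R / (8 * K)%:R = s0%:R * (4 * K%:R)^-1 * 2^-1 :> R.
  by rewrite natrM; field; rewrite gt_eqF.
have : s0%:R * (4 * K%:R)^-1 <= s%:R * (q ^+ i - q ^+ j).
  by rewrite ler_pM// invr_ge0; nra.
rewrite e mulrBr; move: hi hj; clear; lra.
Qed.

Lemma geo_ge (R : realFieldType) (K s0 s i : nat) : (0 < K)%N ->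
  (8 * K <= s0)%N -> (s0 <= s)%N -> (i <= K)%N ->
  s0%:R / (8 * K)%:R <= (geo K s i)%:R :> R.
Proof.
move=> K0 Ks0 s0s iK.
have [_ hi] := geo_bounds R s i K0.
have hh := geo_ratio_half R K0 iK.
have s0R : s0%:R <= s%:R :> R by rewrite ler_nat.
have : s0%:R / (8 * K)%:R <= s0%:R * 8^-1 :> R.
  rewrite ler_wpM2l// lef_pV2 ?posrE ?ltr0n ?muln_gt0 ?K0// ler_nat; lia.
have : 8 <= s0%:R :> R by rewrite ler_nat; lia.
have : s0%:R * 2^-1 <= s%:R * (((2 * K - 1)%:R / (2 * K)%:R) ^+ i) :> R.
  by rewrite ler_pM// invr_ge0.
move: hi; clear; lra.
Qed.

(** Before rounding both products equal s^2 q^(al + a), where q is the ratio; rounding lowers each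
    of them by at most 3 M. *)
Lemma geo_prod (R : realFieldType) (K M s al a ka h : nat) : (0 < K)%N ->
  (0 < M)%N -> (al + a = ka + h)%N ->
  (geo K s al < M)%N -> (geo K s a < M)%N -> (geo K s ka < M)%N -> (geo K s h < M)%N ->
  `|(geo K s h)%:R * (geo K s ka)%:R - (geo K s al)%:R * (geo K s a)%:R| <= 6 * M%:R :> R.
Proof.
move=> K0 M0 e l1 l2 l3 l4.
have prod i j : (geo K s i < M)%N -> (geo K s j < M)%N -> exists2 d : R,
    0 <= d <= 3 * M%:R & s%:R ^+ 2 * ((2 * K - 1)%:R / (2 * K)%:R) ^+ (i + j) =
    (geo K s i)%:R * (geo K s j)%:R + d.
  move=> iM jM.
  have [li ui] := geo_bounds R s i K0; have [lj uj] := geo_bounds R s j K0.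
  set r := _ / _ in li ui lj uj *.
  exists (s%:R ^+ 2 * r ^+ (i + j) - (geo K s i)%:R * (geo K s j)%:R); last by rewrite addrC subrK.
  rewrite exprD (_ : s%:R ^+ 2 * (_ * _) = (s%:R * r ^+ i) * (s%:R * r ^+ j)); last by ring.
  move: (_ * _ ^+ i) (_ * _ ^+ j) li ui lj uj => y z.
  have gi : (geo K s i)%:R + 1 <= M%:R :> R by rewrite natr1 ler_nat.
  have gj : (geo K s j)%:R + 1 <= M%:R :> R by rewrite natr1 ler_nat.
  have g0 : 0 <= (geo K s i)%:R :> R by [].
  have g1 : 0 <= (geo K s j)%:R :> R by [].
  move: (geo K s i)%:R (geo K s j)%:R g0 g1 gi gj => u v g0 g1 gi gj h1 h2 h3 h4.
  apply/andP; split; first by nra.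
  have : y * z <= (u + 1) * (v + 1) by rewrite ler_pM//; lra.
  nra.
have [d hd ed] := prod _ _ l1 l2; have [d' hd' ed'] := prod _ _ l4 l3.
move: ed; rewrite e addnC ed'; move: (_ * _) => x; move: (_ * _) => y.
by move=> exy; rewrite ler_norml; move: hd hd' exy => /andP[? ?] /andP[? ?] ?; apply/andP; split; lra.
Qed.

(** Subtracting the two bounds already gives the estimate with [sg]; it is weakened to [sg ^+ 3] to
    match [quadrilateral_estimate]. *)
Lemma two_point_estimate (R : realFieldType) (a b sg E p w : R) :
  0 < sg -> sg <= 1 -> sg <= `|a - b| -> `|p + a * w| <= E -> `|p + b * w| <= E ->
  sg ^+ 3 * `|w| <= 2 * E.
Proof.
move=> sg0 sg1 hs h1 h2.
have : sg * `|w| <= 2 * E.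
  apply: (@le_trans _ _ (`|a - b| * `|w|)); first by rewrite ler_wpM2r.
  rewrite -normrM (_ : (a - b) * w = (p + a * w) - (p + b * w)); last by ring.
  by rewrite (le_trans (ler_normB _ _))// mulr_natl mulr2n lerD.
apply: le_trans; rewrite ler_wpM2r// exprS -[leRHS]mulr1 ler_wpM2l ?(ltW sg0)//.
by rewrite exprn_ile1// ltW.
Qed.

(** * The counting inequality for a finite family of lines *)

Section Count.
Variables (R : realFieldType) (n : nat) (D J : finType).
Variables (P w : D -> 'I_n -> R) (f : D -> nat -> J) (T : D -> nat -> bool).
Variables (u s0 Q : nat) (rho : R).
Let c := (96 * u ^ 2)%N.
Let K := (16 * c ^ 2)%N.
Let M := (8 * u * s0)%N.
Hypotheses (u0 : (0 < u)%N) (D0 : (0 < #|D|)%N) (Ks0 : (8 * K <= s0)%N).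
Hypothesis T_dense : forall e, (M <= u * #|[set m : 'I_M | T e m]|)%N.
Hypothesis f_fiber : forall j,
  (#|[set m : 'I_M | [exists e, T e m && (f e m == j)]]| <= Q)%N.
Let pt e m i := P e i + m%:R / M%:R * w e i.
Hypothesis f_close : forall e e' m i, T e m -> T e' m -> f e m = f e' m ->
  `|pt e m i - pt e' m i| <= 3 / M%:R.
Hypothesis w_le1 : forall e i, `|w e i| <= 1.
Hypothesis w_sep : forall e e', (forall i, `|w e i - w e' i| <= rho) -> e = e'.
Hypothesis rho_big : 72 * (64 * u * K)%:R ^+ 3 / M%:R <= rho.

Let c0 : (0 < c)%N. Proof. by rewrite /c muln_gt0 expn_gt0 u0. Qed.
Let K0 : (0 < K)%N. Proof. by rewrite /K muln_gt0 expn_gt0 c0. Qed.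
Let s00 : (0 < s0)%N. Proof. by apply: leq_trans Ks0; rewrite muln_gt0 K0. Qed.
Let M0 : (0 < M)%N. Proof. by rewrite /M !muln_gt0 u0 s00. Qed.

Let labels m := [set f e m | e in [set e | T e m]].
(** By [sum_labels] and Markov's inequality, at most M / (2u) heights carry more than [N] labels;
    dropping them leaves at least half of the required density of each [T e]. *)
Let N := ((2 * u * Q * #|J|) %/ M)%N.

(** Double counting of the pairs of a height and a label seen there: a label is seen at no more than
    [Q] heights. *)
Lemma sum_labels : (\sum_(m < M) #|labels m| <= Q * #|J|)%N.
Proof.
have lE m : #|labels m| = (\sum_j [exists e, T e m && (f e m == j)])%N.
  rewrite -sum1_card big_mkcond /=; apply: eq_bigr => j _.
  congr nat_of_bool; apply/imsetP/existsP => [[e + ->]|[e /andP[eT /eqP <-]]].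
    by rewrite inE => eT; exists e; rewrite eT eqxx.
  by exists e => //; rewrite inE.
under eq_bigr => m _ do rewrite lE.
rewrite exchange_big /= mulnC -sum_nat_const; apply: leq_sum => j _.
apply: leq_trans (f_fiber j); rewrite -sum1dep_card [leqRHS]big_mkcond /=.
by apply: leq_sum => m _; case: ifP.
Qed.

Let T' e m := T e m && (#|labels m| <= N)%N.

Lemma dense_good e : (M <= 2 * u * #|[set m : 'I_M | T' e m]|)%N.
Proof.
pose bad := [set m : 'I_M | (N < #|labels m|)%N].
have hbad : (2 * u * #|bad| <= M)%N.
  have [QJ|QJ] := posnP (Q * #|J|)%N.
    suff -> : bad = set0 by rewrite cards0 muln0.
    apply/setP => m; rewrite !inE; apply/negbTE; rewrite -leqNgt.
    have := sum_labels; rewrite QJ leqn0 sum_nat_eq0 => /forallP /(_ m) /=.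
    by move=> /eqP ->.
  rewrite -(leq_pmul2r QJ).
  apply: (@leq_trans (M * \sum_(m < M) #|labels m|)); last by rewrite leq_mul2l sum_labels orbT.
  rewrite (_ : 2 * u * #|bad| * (Q * #|J|) = #|bad| * (2 * u * Q * #|J|))%N; last by lia.
  rewrite -sum_nat_const big_distrr /= big_mkcond /=; apply: leq_sum => m _.
  rewrite inE; case: ifP => //.
  by rewrite /N ltn_divLR// => /ltnW; rewrite (mulnC M).
have : (#|[set m : 'I_M | T e m]| <= #|[set m : 'I_M | T' e m]| + #|bad|)%N.
  apply: leq_trans (leq_card_setU _ _); apply/subset_leq_card/subsetP => m.
  by rewrite !inE /T' => ->; rewrite leqNgt /= orNb.
move=> h; have {h} : (u * #|[set m : 'I_M | T e m]| <=
    u * (#|[set m : 'I_M | T' e m]| + #|bad|))%N by rewrite leq_mul2l h orbT.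
have := T_dense e; move: hbad; rewrite mulnDr -!mulnA.
move: (u * _)%N (u * _)%N (u * _)%N => x y z; lia.
Qed.

(** For two quadrilaterals with the same three labels ([x] and [x'] at al, [y'] at ka), the
    coordinate differences satisfy [quadrilateral_estimate]. Separation then identifies one side,
    and the other three follow by comparing positions at two heights. *)
Lemma line_quadrilaterals (G : {set D}) (k s al a ka h : nat) :
  (k < M)%N -> (s0 <= s)%N ->
  (al < a)%N -> (a < K)%N -> (ka < h)%N -> (h < K)%N ->
  (al + a = ka + h)%N -> al != ka ->
  (forall e, e \in G -> T' e k /\
    {in [:: al; a; ka; h], forall i, (k + geo K s i < M)%N /\ T' e (k + geo K s i)}) ->
  (#|G| ^ 4 <= N ^ 7)%N.
Proof.
move=> kM s0s ala aK kah hK eq4 neq GT.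
have [[alK aK' kaK hK'] [n_aal n_ha n_hal n_aka]] :
    [/\ al <= K, a <= K, ka <= K & h <= K]%N /\
    [/\ a != al, h != a, h != al & a != ka].
  by move: (K) ala aK kah hK eq4 neq => k0; clear; split; split; lia.
have labN m : (forall e, e \in G -> T' e m) -> (#|[set f e m | e in G]| <= N)%N.
  move=> GTm; case: (set_0Vmem G) => [->|[e0 e0G]]; first by rewrite imset0 cards0.
  move/andP: (GTm _ e0G) => [_]; apply: leq_trans.
  apply/subset_leq_card/imsetS/subsetP => e /GTm /andP[eT _].
  by rewrite inE.
have hT i : i \in [:: al; a; ka; h] -> forall e, e \in G -> T' e (k + geo K s i).
  by move=> hi e eG; have [_ /(_ i hi) []] := GT _ eG.
have [n1 n2 n3 n4] : [/\ al \in [:: al; a; ka; h], a \in [:: al; a; ka; h],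
    ka \in [:: al; a; ka; h] & h \in [:: al; a; ka; h]] by rewrite !inE !eqxx !orbT.
have Tk e : e \in G -> T' e k by move=> /GT [].
have [e0 _] : exists e : D, true by case/card_gt0P: D0 => e _; exists e.
have [G0|[e1 e1G]] := set_0Vmem G; first by rewrite G0 cards0 exp0n.
have lt i : i \in [:: al; a; ka; h] -> (geo K s i < M)%N.
  by move=> hi; have [_ /(_ i hi) [+ _]] := GT _ e1G; apply: leq_ltn_trans; rewrite leq_addl.
pose H i : R := (geo K s i)%:R / M%:R.
(* The gap [s0 / (8 * K)] of [geo_gap], rescaled by [M = 8 * u * s0]. *)
pose sg : R := (64 * u * K)%:R^-1.
have MR : 0 < M%:R :> R by rewrite ltr0n.
have MV : 0 <= M%:R^-1 :> R by rewrite invr_ge0.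
have sgE : sg = s0%:R / (8 * K)%:R / M%:R.
  have uR : u%:R != 0 :> R by rewrite pnatr_eq0 -lt0n.
  have sR : s0%:R != 0 :> R by rewrite pnatr_eq0 -lt0n.
  have : K%:R != 0 :> R by rewrite pnatr_eq0 -lt0n.
  rewrite /sg /M (natrM R (64 * u) K) (natrM R 8 K) (natrM R 64 u) (natrM R (8 * u) s0) (natrM R 8 u).
  by move: (K%:R : R) => k0 k00; field; rewrite k00 uR sR.
have uK0 : (0 < 64 * u * K)%N by rewrite (muln_gt0 (64 * u) K) muln_gt0 u0 K0.
have sg0 : 0 < sg by rewrite invr_gt0 ltr0n.
have sg1 : sg <= 1.
  by rewrite invf_le1 ?ler1n ?ltr0n.
have gap i j : (i <= K)%N -> (j <= K)%N -> i != j -> sg <= `|H i - H j|.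
  move=> iK jK ij; rewrite /H -mulrBl normrM (ger0_norm MV).
  rewrite sgE ler_wpM2r ?invr_ge0//.
  have [lt_ij|lt_ji|eq_ij] := ltngtP i j; last by rewrite eq_ij eqxx in ij.
    by apply: le_trans (ler_norm _); exact: geo_gap.
  by rewrite distrC; apply: le_trans (ler_norm _); exact: geo_gap.
have Hal : sg <= H al by rewrite sgE ler_wpM2r ?invr_ge0// geo_ge.
have H01 i : i \in [:: al; a; ka; h] -> 0 <= H i <= 1.
  by move=> /lt li; rewrite divr_ge0//= ler_pdivrMr// mul1r ler_nat ltnW.
have Hprod : `|H h * H ka - H al * H a| <= 6 / M%:R.
  have := geo_prod R K0 M0 eq4 (lt _ n1) (lt _ n2) (lt _ n3) (lt _ n4).
  have -> : H h * H ka - H al * H a =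
     ((geo K s h)%:R * (geo K s ka)%:R - (geo K s al)%:R * (geo K s a)%:R) / M%:R / M%:R.
    by rewrite /H; field; rewrite gt_eqF.
  rewrite !normrM !(ger0_norm MV) => hp.
  by rewrite ler_wpM2r// ler_pdivrMr.
have ptD e v i : pt e (k + v) i = pt e k i + v%:R / M%:R * w e i.
  by rewrite /pt natrD; ring.
have rho_sg (x : R) : sg ^+ 3 * x <= 72 / M%:R -> x <= rho.
  move=> hx; apply: le_trans rho_big.
  rewrite -(@ler_pM2l _ (sg ^+ 3)) ?exprn_gt0//; apply: le_trans hx _.
  by rewrite mulrA mulrCA -exprMn mulVf ?expr1n ?mulr1// gt_eqF// ltr0n.
have E9 : 3 / M%:R + 3 / M%:R = 6 / M%:R :> R by rewrite -mulrDl -natrD.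
apply: (@quadrilateral_count D J G N (fun e => f e (k + geo K s a)) (fun e => f e (k + geo K s h))
   (fun e => f e k) (fun e => f e (k + geo K s al)) (fun e => f e (k + geo K s ka)));
  [exact: labN (hT _ n2) | exact: labN (hT _ n4) | exact: labN Tk
  | exact: labN (hT _ n1) | exact: labN (hT _ n3) |].
move=> x x' y y' z z' t t' xG x'G yG y'G zG z'G tG t'G.
move=> axx' ayy' hxy kx'y' azz' att' hzt kz't' alxz alx'z' kay't'.
have T'T e m : T' e m -> T e m by case/andP.
have cl i j e e' : i \in [:: al; a; ka; h] -> e \in G -> e' \in G ->
    f e (k + geo K s i)%N = f e' (k + geo K s i)%N ->
  `|pt e k j - pt e' k j + H i * (w e j - w e' j)| <= 3 / M%:R.
  move=> hi eG e'G ff; have := f_close j (T'T _ _ (hT i hi _ eG)) (T'T _ _ (hT i hi _ e'G)) ff.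
  by rewrite !ptD -/(H i); congr (`| _ | <= _); ring.
have cl2 (i : nat) j e e' d d' : i \in [:: al; a; ka; h] -> e \in G -> e' \in G -> d \in G -> d' \in G ->
    f e (k + geo K s i)%N = f e' (k + geo K s i)%N ->
    f d (k + geo K s i)%N = f d' (k + geo K s i)%N ->
  `|(pt e k j - pt d k j + H i * (w e j - w d j)) -
    (pt e' k j - pt d' k j + H i * (w e' j - w d' j))| <= 6 / M%:R.
  move=> hi eG e'G dG d'G ff gg; have h1 := cl i j e e' hi eG e'G ff.
  have h2 := cl i j d d' hi dG d'G gg.
  rewrite -E9; apply: le_trans (lerD h1 h2); apply: le_trans (ler_normB _ _).
  by rewrite le_eqVlt; apply/orP; left; apply/eqP; congr `| _ |; ring.
have ble e e' j : `|w e j - w e' j| <= 2.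
  by rewrite (le_trans (ler_normB _ _))// (_ : 2 = 1 + 1)// lerD.
have le36 : 3 / M%:R <= 6 / M%:R :> R by rewrite ler_wpM2r// ler_nat.
(* With E = eta = 6 / M the right-hand side of the estimate is 72 / M, the constant in [rho_big]. *)
have yt : y = t.
  apply: w_sep => j; apply: rho_sg.
  have := @quadrilateral_estimate R (H al) (H a) (H ka) (H h) sg (6 / M%:R) (6 / M%:R)
    (pt x k j - pt z k j) (w x j - w z j) (pt x' k j - pt z' k j) (w x' j - w z' j)
    (pt y k j - pt t k j) (w y j - w t j) (pt y' k j - pt t' k j) (w y' j - w t' j).
  have -> : 10 * (6 / M%:R) + 2 * (6 / M%:R) = 72 / M%:R :> R by field; rewrite gt_eqF.
  apply=> //.
  - by case/andP: (H01 al n1).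
  - exact: H01.
  - exact: gap.
  - exact: gap.
  - exact: le_trans (cl al j x z n1 xG zG alxz) le36.
  - exact: le_trans (cl al j x' z' n1 x'G z'G alx'z') le36.
  - exact: le_trans (cl ka j y' t' n3 y'G t'G kay't') le36.
  - exact: cl2.
  - exact: cl2.
  - exact: cl2.
  - have h1 := f_close j (T'T _ _ (Tk _ x'G)) (T'T _ _ (Tk _ y'G)) kx'y'.
    have h2 := f_close j (T'T _ _ (Tk _ z'G)) (T'T _ _ (Tk _ t'G)) kz't'.
    rewrite -E9; apply: le_trans (lerD h1 h2); apply: le_trans (ler_normB _ _).
    by rewrite le_eqVlt; apply/orP; left; apply/eqP; congr `| _ |; ring.
(* Lines close at two distinct heights have close directions, hence coincide. This is used along the
   chain x, x', y', each side inheriting one height from a side already identified and the other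
   from its label. *)
have two (i j : nat) e e' : (i <= K)%N -> (j <= K)%N -> i != j ->
    (forall l, `|pt e k l - pt e' k l + H i * (w e l - w e' l)| <= 6 / M%:R) ->
    (forall l, `|pt e k l - pt e' k l + H j * (w e l - w e' l)| <= 6 / M%:R) -> e = e'.
  move=> iK jK ij h1 h2; apply: w_sep => l; apply: rho_sg.
  apply: le_trans (two_point_estimate sg0 sg1 (gap _ _ iK jK ij) (h1 l) (h2 l)) _.
  by rewrite mulrA ler_wpM2r// -natrM ler_nat.
have xz : x = z.
  apply: (two h al) => //.
    by move=> l; have := cl2 h l x y z t n4 xG yG zG tG hxy hzt; rewrite yt !subrr mulr0 addr0 subr0.
  by move=> l; exact: le_trans (cl al l x z n1 xG zG alxz) le36.
have xz' : x' = z'.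
  apply: (two a al) => //.
    move=> l; have := cl2 a l x x' z z' n2 xG x'G zG z'G axx' azz'.
    by rewrite xz !subrr mulr0 addr0 sub0r normrN.
  by move=> l; exact: le_trans (cl al l x' z' n1 x'G z'G alx'z') le36.
have yt' : y' = t'.
  apply: (two a ka) => //.
    move=> l; have := cl2 a l y y' t t' n2 yG y'G tG t'G ayy' att'.
    by rewrite yt !subrr mulr0 addr0 sub0r normrN.
  by move=> l; exact: le_trans (cl ka l y' t' n3 y'G t'G kay't') le36.
by split.
Qed.

Lemma kakeya_count :
  (#|D| ^ 4 * M ^ 7 <= (c * K ^ 4) ^ 4 * (2 * u * Q * #|J|) ^ 7)%N.
Proof.
have [k [s [al [a [ka [h [G]]]]]]] := common_heights u0 s00 D0 dense_good.
case=> [[kM s0s _] [ala aK kah hK] [eq4 neq] DG GT].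
have GN := line_quadrilaterals kM s0s ala aK kah hK eq4 neq GT.
have NM : (N * M <= 2 * u * Q * #|J|)%N by exact: leq_trunc_div.
apply: (@leq_trans ((c * K ^ 4) ^ 4 * (#|G| ^ 4 * M ^ 7))).
  by rewrite mulnA leq_mul2r -expnMn leq_exp2r// DG orbT.
rewrite leq_mul2l; apply/orP; right.
apply: (@leq_trans (N ^ 7 * M ^ 7)); first by rewrite leq_mul2r GN orbT.
by rewrite -expnMn leq_exp2r.
Qed.

End Count.

(** * Hausdorff premeasures *)

From mathcomp Require Import all_classical all_reals all_analysis.
Import numFieldNormedType.Exports.
Local Open Scope classical_set_scope.

Section Hausdorff.
Variables (R : realType) (n : nat).
Implicit Types (s delta : R) (A : set 'rV[R]_n).

Lemma ediam_pow_ge0 s A : (0 <= ediam_pow s A)%E.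
Proof. by rewrite /ediam_pow; case: ifP => // _; exact: poweR_ge0. Qed.

Lemma hausdorff_pre_ge0 s delta A : (0 <= hausdorff_pre s delta A)%E.
Proof.
apply: le_ereal_inf_tmp => _ [F _ <-].
by apply: nneseries_ge0 => i _ _; exact: ediam_pow_ge0.
Qed.

Lemma hausdorff_pre_le_measure s delta A : 0 < delta ->
  (hausdorff_pre s delta A <= hausdorff_measure s A)%E.
Proof. by move=> d0; apply: ereal_sup_ubound; exists delta. Qed.

Lemma hausdorff_pre_subset s delta A B : A `<=` B ->
  (hausdorff_pre s delta A <= hausdorff_pre s delta B)%E.
Proof.
move=> AB; apply: le_ereal_inf => _ [F [Fd BF] <-]; exists F => //; split => //.
exact: subset_trans BF.
Qed.

(** The strict bounds provide a cover of each [A k] of cost at most [eps / 2 ^ k.+1]; these covers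
    are merged along a bijection of nat with nat * nat. *)
Lemma hausdorff_pre_bigcup s delta eps (A : (set 'rV[R]_n)^nat) : 0 <= eps ->
  (forall k, hausdorff_pre s delta (A k) < (eps / (2 ^ k.+1)%:R)%:E)%E ->
  (hausdorff_pre s delta (\bigcup_k A k) <= eps%:E)%E.
Proof.
move=> eps0 hA.
have /choice[G hG] : forall k, exists F : (set 'rV[R]_n)^nat,
    [/\ forall i, (ediam (F i) <= delta%:E)%E, A k `<=` \bigcup_i F i &
    (\sum_(0 <= i <oo) ediam_pow s (F i) <= (eps / (2 ^ k.+1)%:R)%:E)%E].
  by move=> k; have [_ [F [Fd AF] <-] /ltW lt] := ereal_inf_lt (hA k); exists F.
have /card_esym/ppcard_eqP[f] := card_nat2.
apply: (@le_trans _ _ (\sum_(0 <= p <oo) ediam_pow s (G (f p).1 (f p).2))%E).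
  apply: ereal_inf_lbound; exists (fun p => G (f p).1 (f p).2) => //.
  split=> [p|x [k _ /=]]; first by have [+ _ _] := hG (f p).1; exact.
  have [_ + _] := hG k => /[apply] -[j _ Gx]; exists (f^-1%FUN (k, j)) => //=.
  by rewrite invK ?inE.
rewrite nneseries_esumT; last by move=> p; exact: ediam_pow_ge0.
rewrite -(@reindex_esum R nat (nat * nat)%type setT setT f
   (fun q => ediam_pow s (G q.1 q.2))); last exact: bij.
rewrite (_ : setT = setT `*`` (fun=> setT)); last by apply/seteqP; split.
rewrite -(@esum_esum R nat nat setT (fun=> setT) (fun i j => ediam_pow s (G i j))); last first.
  by move=> *; exact: ediam_pow_ge0.
rewrite -nneseries_esumT; last by move=> k; apply: esum_ge0 => *; exact: ediam_pow_ge0.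
apply: le_trans (epsilon_trick0 xpredT eps0).
apply: lee_nneseries => [k _ _|k _]; first by apply: esum_ge0 => *; exact: ediam_pow_ge0.
rewrite -nneseries_esumT; last by move=> j; exact: ediam_pow_ge0.
by have [] := hG k.
Qed.

Lemma hausdorff_measure_bigcup0 (T : countType) s (A : T -> set 'rV[R]_n) :
  (forall t, hausdorff_measure s (A t) = 0%E) ->
  hausdorff_measure s (\bigcup_t A t) = 0%E.
Proof.
move=> hA; apply/eqP; rewrite eq_le; apply/andP; split; last first.
  by apply: le_trans (@hausdorff_pre_ge0 s 1 _) _; exact: hausdorff_pre_le_measure.
apply: ge_ereal_sup => _ [delta d0 <-].
apply/lee_addgt0Pr => eps eps0; rewrite add0e.
(* Codes of no element of [T] receive the empty set, whose premeasure is 0. *)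
pose B k := if unpickle k is Some t then A t else set0.
apply: (@le_trans _ _ (hausdorff_pre s delta (\bigcup_k B k))).
  apply: hausdorff_pre_subset => x [t _ Ax]; exists (pickle t) => //.
  by rewrite /B pickleK.
apply: hausdorff_pre_bigcup; first exact: ltW.
move=> k; apply: (@le_lt_trans _ _ 0%E); last by rewrite lte_fin divr_gt0// ltr0n expn_gt0.
rewrite /B; case: unpickle => [t|]; first by rewrite -(hA t) hausdorff_pre_le_measure.
apply: ereal_inf_lbound; exists (fun=> set0).
  by split=> // i; apply: ge_ereal_sup => _ [[x y] [[]]].
by apply: eseries0 => i _ _; rewrite /ediam_pow eqxx.
Qed.

Lemma hausdorff_pre_finite_cover s delta r (d : nat) A (B : 'I_d -> set 'rV[R]_n) :
  0 <= s -> 0 <= r -> r <= delta ->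
  (forall i, (ediam (B i) <= r%:E)%E) -> (A `<=` \bigcup_i B i) ->
  (hausdorff_pre s delta A <= (d%:R * r `^ s)%:E)%E.
Proof.
move=> s0 r0 rd Br AB.
(* The finite cover is padded by empty sets, which cost nothing, even for [s = 0], by the convention
   in [ediam_pow]. *)
pose F i := if insub i is Some j then B j else set0.
have FB i : (ediam_pow s (F i) <= (r `^ s)%:E)%E.
  rewrite /ediam_pow; case: eqP => [_|/eqP/set0P[x Fx]].
    by rewrite lee_fin powR_ge0.
  have Fr : (ediam (F i) <= r%:E)%E.
    move: Fx; rewrite /F; case: insub => // j _; exact: Br.
  have F0 : (0 <= ediam (F i))%E.
    apply: ereal_sup_ge; exists (enorm (x - x))%:E; first by exists (x, x).
    by rewrite lee_fin sqrtr_ge0.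
  rewrite -poweR_EFin; apply: gt0_ler_poweR => //; rewrite in_itv/= ?leey ?andbT//.
apply: (@le_trans _ _ (\sum_(0 <= i <oo) ediam_pow s (F i))%E).
  apply: ereal_inf_lbound; exists F => //; split.
    move=> i; rewrite /F; case: insub => [j|].
      by apply: le_trans (Br j) _; rewrite lee_fin.
    by apply: ge_ereal_sup => _ [[x y] [[]]].
  by move=> x /AB[j _ Bx]; exists j => //; rewrite /F valK.
rewrite (nneseries_split 0%N d); last by move=> *; exact: ediam_pow_ge0.
rewrite eseries0; last first.
  move=> i; rewrite add0n => di _.
  rewrite /ediam_pow (_ : F i = set0) ?eqxx// /F insubF//.
  by apply/negbTE; rewrite -leqNgt.
rewrite adde0 add0n.
apply: (@le_trans _ _ (\sum_(0 <= i < d) (r `^ s)%:E)%E); first exact: lee_sum.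
by rewrite sumEFin lee_fin sumr_const_nat subn0 mulr_natl.
Qed.

End Hausdorff.

(** Greedy choice: as long as at most [d] points have been chosen, some point of [A] is near none of
    them. *)
Lemma separated_family (T : Type) (near : T -> T -> Prop) (A : set T) (d : nat) (x0 : T) :
  (forall k (x : nat -> T), (k <= d)%N -> (forall i, (i < k)%N -> A (x i)) ->
     exists2 y, A y & forall i, (i < k)%N -> ~ near (x i) y) ->
  exists2 x : nat -> T, (forall i, (i <= d)%N -> A (x i)) &
    forall i j, (i < j)%N -> (j <= d)%N -> ~ near (x i) (x j).
Proof.
move=> next.
suff /(_ d.+1 (leqnn _)) [x Ax sep] : forall k, (k <= d.+1)%N ->
    exists2 x : nat -> T, (forall i, (i < k)%N -> A (x i)) &
      forall i j, (i < j)%N -> (j < k)%N -> ~ near (x i) (x j) by exists x.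
elim=> [|k IH] kd; first by exists (fun=> x0).
have [x Ax sep] := IH (ltnW kd); have [y Ay hy] := next k x kd Ax.
exists (fun i => if i == k then y else x i).
  move=> i; rewrite ltnS leq_eqVlt; case: eqP => [//|_ /= ik]; exact: Ax.
move=> i j ij; rewrite ltnS leq_eqVlt.
have [jk|_ /= jk] := eqVneq j k.
  by move=> _; rewrite jk in ij *; rewrite (ltn_eqF ij); exact: hy.
by rewrite (ltn_eqF (ltn_trans ij jk)); exact: sep.
Qed.

(** If every scale failed, the intervals selected at scale l would have total length below 2^-l.
    Summed over l >= 2 this is at most 1/2, too little to cover [0, 1). *)
Lemma dense_scale (R : realType) (l0 : nat) (Mx : nat -> nat) (T : nat -> nat -> bool) :
  (2 <= l0)%N -> (forall l, (0 < Mx l)%N) ->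
  (forall th : R, 0 <= th < 1 -> exists l m, [/\ (l0 <= l)%N, (m < Mx l)%N, T l m &
     m%:R / (Mx l)%:R <= th <= m.+1%:R / (Mx l)%:R]) ->
  exists2 l, (l0 <= l)%N & (Mx l <= 2 ^ l * \sum_(m < Mx l) T l m)%N.
Proof.
move=> l2 M0 cov; apply: contrapT => nex.
have lt l : (l0 <= l)%N -> (2 ^ l * \sum_(m < Mx l) T l m < Mx l)%N.
  by move=> ll; rewrite ltnNge; apply/negP => le; apply: nex; exists l.
pose F l m : set R := if T l m then `[m%:R / (Mx l)%:R, m.+1%:R / (Mx l)%:R]%classic else set0.
have mF l m : measurable (F l m) by rewrite /F; case: ifP.
pose A k := \big[setU/set0]_(m < Mx (l0 + k)%N) F (l0 + k)%N m.
have mA k : measurable (A k) by apply: bigsetU_measurable.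
have cover : (`[0%R, 1%R[%classic : set R) `<=` \bigcup_k A k.
  move=> th /=; rewrite in_itv/= => /cov[l [m [ll mM Tm hth]]].
  exists (l - l0)%N => //; rewrite /A subnKC// -bigcup_mkord; exists m => //.
  by rewrite /F Tm /= in_itv.
have muA k : (lebesgue_measure (A k) <= (2^-1 / (2 ^ k.+1)%:R)%:E)%E.
  set l := (l0 + k)%N.
  apply: (@le_trans _ _ (\sum_(m < Mx l) lebesgue_measure (F l m))%E).
    by apply: Boole_inequality => m _; exact: mF.
  have MR : 0 < (Mx l)%:R :> R by rewrite ltr0n.
  have muF m : lebesgue_measure (F l m) = ((T l m)%:R / (Mx l)%:R)%:E.
    rewrite /F; case: (T l m); last by rewrite measure0 mul0r.
    rewrite lebesgue_measure_itv /= lte_fin ltr_pM2r ?invr_gt0// ltr_nat ltnSn.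
    by rewrite -EFinB -mulrBl -natrB// subSnn.
  rewrite (eq_bigr (fun m : 'I_(Mx l) => ((T l m)%:R / (Mx l)%:R)%:E)); last by move=> m _; exact: muF.
  rewrite sumEFin lee_fin -mulr_suml ler_pdivrMr//.
  have /ltnW := lt l (leq_addr k l0); rewrite -(ler_nat R) natrM natr_sum => h.
  rewrite -(@ler_pM2l _ (2 ^ l)%:R) ?ltr0n ?expn_gt0//.
  apply: le_trans h _; rewrite mulrA mulrA -[leLHS]mul1r ler_wpM2r//.
  rewrite ler_pdivlMr ?ltr0n ?expn_gt0// mul1r ler_pdivlMr// -natrM ler_nat.
  by rewrite -expnSr leq_exp2l// /l -[k.+2]add2n leq_add2r.
have : (lebesgue_measure (`[0%R, 1%R[%classic : set R) <= (2^-1)%:E)%E.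
  have h := measure_sigma_subadditive lebesgue_measure mA (measurable_itv _) cover.
  apply: (le_trans h).
  apply: le_trans (epsilon_trick0 xpredT _); last by rewrite invr_ge0.
  by apply: lee_nneseries => // k _; exact: muA.
rewrite lebesgue_measure_itv /= lte_fin ltr01 sube0 lee_fin.
by rewrite leNgt invf_lt1// ltr1n.
Qed.

(** * Segments over a fixed interval of heights *)

Section Euclid.
Variables (R : realType) (n : nat).
Implicit Types (x e : 'rV[R]_n).

Lemma esphere_sum e : esphere e -> \sum_i e ord0 i ^+ 2 = 1.
Proof.
rewrite /esphere /= /enorm => /(congr1 (fun y => y ^+ 2)).
by rewrite expr1n sqr_sqrtr// sumr_ge0// => i _; exact: sqr_ge0.
Qed.

Lemma coord_le_enorm x i : `|x ord0 i| <= enorm x.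
Proof.
rewrite /enorm -sqrtr_sqr ler_wsqrtr// (bigD1 i)//= lerDl.
by rewrite sumr_ge0// => j _; exact: sqr_ge0.
Qed.

Lemma enorm_le_sum x : enorm x <= \sum_i `|x ord0 i|.
Proof.
have s0 : 0 <= \sum_i `|x ord0 i| by rewrite sumr_ge0.
rewrite -[leRHS]ger0_norm// -sqrtr_sqr ler_wsqrtr//.
rewrite expr2 mulr_suml ler_sum// => i _.
rewrite -real_normK ?num_real// expr2 ler_wpM2l//.
by rewrite (bigD1 i)//= lerDl sumr_ge0.
Qed.

Lemma enorm_le_ediam (A : set 'rV[R]_n) (d : R) x y :
  (ediam A <= d%:E)%E -> A x -> A y -> enorm (x - y) <= d.
Proof.
move=> Ad Ax Ay; rewrite -lee_fin; apply: le_trans Ad.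
by apply: ereal_sup_ubound; exists (x, y).
Qed.

(* Normalised so that the height [q.+1 * x_j - z] has slope 1 along the line. *)
Definition slope (j : 'I_n) (q : nat) e (i : 'I_n) : R :=
  e ord0 i / (q.+1%:R * e ord0 j).

(* The segment crosses the slab z <= q.+1 * x_j <= z + 1; [sg] records the sign
   of e_j, which together with the slope determines e. *)
Definition segment_class (X : set 'rV[R]_n) (c : 'I_n * bool * nat * int) :
    set 'rV[R]_n :=
  let: (j, sg, q, z) := c in
  [set e | exists a, [/\ unit_segment a e `<=` X,
     (if sg then 0 < e ord0 j else e ord0 j < 0) &
     forall th : R, 0 <= th <= 1 -> exists2 tau, 0 <= tau <= 1 &
       a ord0 j + tau * e ord0 j = (z%:~R + th) / q.+1%:R]].

Lemma kakeya_segment_class (Omega X : set 'rV[R]_n) : Omega `<=` @esphere R n ->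
  kakeya_set Omega X -> Omega `<=` \bigcup_c (Omega `&` segment_class X c).
Proof.
move=> sph kak e Oe; have [a aX] := kak e Oe.
have [j ej0] : exists j, e ord0 j != 0.
  apply/existsP; apply: contraT; rewrite negb_exists => /forallP e0.
  have := esphere_sum (sph _ Oe); rewrite big1 => [/eqP|i _]; first by rewrite eq_sym oner_eq0.
  by have := e0 i; rewrite negbK => /eqP ->; rewrite expr0n.
pose b := a ord0 j; pose d := `|e ord0 j|.
have d0 : 0 < d by rewrite normr_gt0.
pose lo := Num.min b (b + e ord0 j).
(* The height [q.+1 * x_j] then varies by at least 2 along the segment, so it sweeps a whole
   interval between consecutive integers; [z] below is the first integer above its minimum. *)
have [q hq] : exists q : nat, 2 <= q.+1%:R * d.
  exists (Num.trunc (2 / d)); rewrite -ler_pdivrMr//.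
  exact/ltW/truncnS_gt.
pose k : R := q.+1%:R; have k0 : 0 < k by rewrite ltr0n.
pose z := Num.floor (k * lo) + 1.
have z1 : k * lo < z%:~R by have /andP[] := floor_itv (k * lo).
have z2 : z%:~R <= k * lo + 1 by rewrite intrD lerD2r floor_le.
exists (j, 0 < e ord0 j, q, z) => //; split => //; exists a; split=> //.
  by case: ifP => // /negbT; rewrite -leNgt le_eqVlt (negbTE ej0).
move=> th th01; exists (((z%:~R + th) / k - b) / e ord0 j); last first.
  by rewrite /b -/k; field; rewrite ej0 gt_eqF.
pose y := (z%:~R + th) / k; rewrite -/y.
have y1 : lo <= y by rewrite /y -/k ler_pdivlMr// (mulrC lo); lra.
have y2 : y <= lo + d.
  by rewrite /y -/k ler_pdivrMr// mulrDl (mulrC lo) (mulrC d); rewrite -/k in hq; lra.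
move: ej0 y1 y2; rewrite /lo /d neq_lt => /orP[ej|ej].
  rewrite min_r; last by lra.
  rewrite ltr0_norm// => y1 y2.
  by rewrite -mulrNN -invrN divr_ge0 ?ler_pdivrMr; lra.
rewrite min_l; last by lra.
rewrite gtr0_norm// => y1 y2.
by rewrite divr_ge0 ?ler_pdivrMr//; lra.
Qed.

(** The slab of height 1 is crossed while the parameter moves by at most 1, which bounds [e ord0 j]
    away from 0. *)
Lemma segment_class_height X j sg q z e : segment_class X (j, sg, q, z) e ->
  1 <= q.+1%:R * `|e ord0 j|.
Proof.
case=> a [_ _ ht].
have [t0 /andP[? ?] e0] := ht 0 ltac:(by rewrite lexx ler01).
have [t1 /andP[? ?] e1] := ht 1 ltac:(by rewrite lexx ler01).
have k0 : 0 < q.+1%:R :> R by rewrite ltr0n.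
have : q.+1%:R * ((t1 - t0) * e ord0 j) = 1.
  rewrite (_ : (t1 - t0) * _ = (a ord0 j + t1 * e ord0 j) - (a ord0 j + t0 * e ord0 j)); last by ring.
  by rewrite e0 e1; field; rewrite gt_eqF.
move=> /(congr1 Num.norm); rewrite normr1 !normrM (gtr0_norm k0) => h; rewrite -[leLHS]h.
rewrite ler_wpM2l ?(ltW k0)// -[leRHS]mul1r ler_wpM2r// ler_norml.
by apply/andP; split; lra.
Qed.

Lemma coord_le1 e i : esphere e -> `|e ord0 i| <= 1.
Proof. by move=> he; rewrite (le_trans (coord_le_enorm _ _))// he. Qed.

Lemma slope_le1 X j sg q z e i : esphere e -> segment_class X (j, sg, q, z) e ->
  `|slope j q e i| <= 1.
Proof.
move=> he /segment_class_height hj; rewrite /slope normrM normfV.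
have k : 1 <= `|q.+1%:R * e ord0 j| by rewrite normrM ger0_norm.
by rewrite ler_pdivrMr ?mul1r ?(lt_le_trans ltr01)// (le_trans _ k)// coord_le1.
Qed.

Lemma segment_class_line X j sg q z e : segment_class X (j, sg, q, z) e ->
  exists P : 'I_n -> R, forall th, 0 <= th <= 1 ->
    X (\row_i (P i + th * slope j q e i)) /\
    q.+1%:R * (P j + th * slope j q e j) - z%:~R = th.
Proof.
move=> he; have := segment_class_height he; case: he => a [aX sgn ht] hj.
have k0 : q.+1%:R != 0 :> R by rewrite pnatr_eq0.
have ej0 : e ord0 j != 0 by move: sgn; case: sg => ?; [rewrite gt_eqF|rewrite lt_eqF].
(* The base point of the line is moved to height z, which is [th = 0]. *)
exists (fun i => a ord0 i + (z%:~R / q.+1%:R - a ord0 j) / e ord0 j * e ord0 i) => th th01.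
split; last by rewrite /slope; move: (q.+1%:R) k0 => k k0; field; rewrite ej0 k0.
have [tau tau01 htau] := ht th th01; apply: aX; exists tau => //.
apply/rowP => i; rewrite !mxE /slope.
have -> : tau = ((z%:~R + th) / q.+1%:R - a ord0 j) / e ord0 j by rewrite -htau; field.
by move: (q.+1%:R) k0 => k k0; field; rewrite ej0 k0.
Qed.

(** Unit length gives (k e_j)^2 times the sum of the squared slopes equal to 1, so the slopes
    control e_j^2. The common sign, with k |e_j| >= 1, keeps the sum of the two j-th coordinates
    away from 0, which turns this into control of e_j, hence of [e]. *)
Lemma slope_near X j sg q z e e' r : esphere e -> esphere e' ->
  segment_class X (j, sg, q, z) e -> segment_class X (j, sg, q, z) e' ->
  (forall i, `|slope j q e i - slope j q e' i| <= r) ->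
  enorm (e - e') <= n%:R * (q.+1%:R + n%:R * q.+1%:R ^+ 4) * r.
Proof.
move=> se se' he he' hr.
have r0 : 0 <= r by apply: le_trans (hr j).
have wl i := slope_le1 i se he; have wl' i := slope_le1 i se' he'.
have hj := segment_class_height he; have hj' := segment_class_height he'.
have sgn : (0 < e ord0 j /\ 0 < e' ord0 j) \/ (e ord0 j < 0 /\ e' ord0 j < 0).
  by move: he he' => [a [_ + _]] [a' [_ + _]]; case: (sg); [left|right].
pose k : R := q.+1%:R; have k1 : 1 <= k by rewrite ler1n.
rewrite -/k in hj hj' *.
pose w := slope j q e; pose w' := slope j q e'.
pose x := e ord0 j; pose x' := e' ord0 j.
have x0 : x != 0 by rewrite /x; case: sgn => -[? ?]; [rewrite gt_eqF|rewrite lt_eqF].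
have x0' : x' != 0 by rewrite /x'; case: sgn => -[? ?]; [rewrite gt_eqF|rewrite lt_eqF].
have k0 : k != 0 by rewrite gt_eqF// (lt_le_trans ltr01).
have eE i : e ord0 i = k * x * w i by rewrite mulrC divfK// mulf_neq0.
have eE' i : e' ord0 i = k * x' * w' i by rewrite mulrC divfK// mulf_neq0.
have S1 : (k * x) ^+ 2 * \sum_i w i ^+ 2 = 1.
  by rewrite -(esphere_sum se) mulr_sumr; apply: eq_bigr => i _; rewrite eE [RHS]exprMn.
have S2 : (k * x') ^+ 2 * \sum_i w' i ^+ 2 = 1.
  by rewrite -(esphere_sum se') mulr_sumr; apply: eq_bigr => i _; rewrite eE' [RHS]exprMn.
have dS : `|\sum_i w' i ^+ 2 - \sum_i w i ^+ 2| <= n%:R * (2 * r).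
  rewrite -sumrB (le_trans (ler_norm_sum _ _ _))//.
  rewrite -[n in leRHS]card_ord -sum1_card natr_sum mulr_suml ler_sum// => i _.
  rewrite mul1r subr_sqr normrM mulrC ler_pM//; last by rewrite distrC.
  by rewrite (le_trans (ler_normD _ _))// (_ : 2 = 1 + 1)// lerD.
have xl : `|x| <= 1 by exact: coord_le1.
have xl' : `|x'| <= 1 by exact: coord_le1.
have dx : `|x - x'| <= k ^+ 3 * (n%:R * r).
  have id : (x - x') * (x + x') = (k * x * x') ^+ 2 * (\sum_i w' i ^+ 2 - \sum_i w i ^+ 2).
    have -> : (k * x * x') ^+ 2 * (\sum_i w' i ^+ 2 - \sum_i w i ^+ 2) =
      x ^+ 2 * ((k * x') ^+ 2 * \sum_i w' i ^+ 2) - x' ^+ 2 * ((k * x) ^+ 2 * \sum_i w i ^+ 2) by ring.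
    by rewrite S1 S2; ring.
  have sumx : 2 <= k * `|x + x'|.
    have -> : `|x + x'| = `|x| + `|x'|.
      by rewrite /x /x'; case: sgn => -[? ?]; [rewrite !gtr0_norm|rewrite !ltr0_norm]; lra.
    by rewrite mulrDr (_ : 2 = 1 + 1)// lerD.
  have idn : `|x - x'| * `|x + x'| = `|k * x * x'| ^+ 2 *
      `|\sum_i w' i ^+ 2 - \sum_i w i ^+ 2|.
    by rewrite -normrM id normrM normrX.
  have b1 : `|x - x'| * `|x + x'| <= k ^+ 2 * (n%:R * (2 * r)).
    have kxx : `|k * x * x'| <= k.
      rewrite !normrM ger0_norm ?(le_trans ler01)// -mulrA -[leRHS]mulr1.
      by rewrite ler_wpM2l ?(le_trans ler01)// -[leRHS]mulr1 ler_pM.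
    by rewrite idn ler_pM ?exprn_ge0// lerXn2r ?nnegrE// (le_trans ler01).
  have : `|x - x'| * 2 <= `|x - x'| * (k * `|x + x'|) by rewrite ler_wpM2l.
  have : k * (`|x - x'| * `|x + x'|) <= k * (k ^+ 2 * (n%:R * (2 * r))).
    by rewrite ler_wpM2l// (le_trans ler01).
  by rewrite !exprS expr0; lra.
have coord i : `|(e - e') ord0 i| <= (k + n%:R * k ^+ 4) * r.
  rewrite !mxE eE eE'.
  have -> : k * x * w i - k * x' * w' i = k * (x * (w i - w' i) + (x - x') * w' i) by ring.
  rewrite normrM ger0_norm ?(le_trans ler01)//.
  have -> : (k + n%:R * k ^+ 4) * r = k * (1 * r + k ^+ 3 * (n%:R * r) * 1) by ring.
  rewrite ler_wpM2l ?(le_trans ler01)// (le_trans (ler_normD _ _))//.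
  rewrite (normrM x) (normrM (x - x')); apply: lerD; apply: ler_pM => //.
apply: le_trans (enorm_le_sum _) _.
have -> : n%:R * (k + n%:R * k ^+ 4) * r = \sum_(i < n) (k + n%:R * k ^+ 4) * r.
  by rewrite sumr_const card_ord -mulrA mulr_natl.
by apply: ler_sum => i _.
Qed.

End Euclid.

(** * Counting at a single scale *)

Lemma card_pred_sum (T : finType) (P : pred T) :
  #|[set x | P x]%SET| = (\sum_x P x)%N.
Proof. by rewrite -sum1dep_card big_mkcond. Qed.

Lemma card_clustered (M b : nat) (S : {set 'I_M}) :
  (forall m m' : 'I_M, m \in S -> m' \in S -> (m <= m' + b)%N) -> (#|S| <= 2 * b + 1)%N.
Proof.
move=> hS; have [->|[m0 m0S]] := set_0Vmem S; first by rewrite cards0.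
pose g (m : 'I_M) : 'I_(2 * b).+1 := inord (m + b - m0)%N.
rewrite -(@card_in_imset _ _ g S); last first.
  move=> m m' mS m'S /(congr1 val); have := hS _ _ mS m0S; have := hS _ _ m0S mS.
  have := hS _ _ m'S m0S; have := hS _ _ m0S m'S => h1 h2 h3 h4.
  rewrite /= !inordK; [|lia|lia] => e.
  by apply: val_inj => /=; lia.
by apply: leq_trans (max_card _) _; rewrite card_ord addn1.
Qed.

(** * Sorting the pieces of a cover by diameter *)

Section Pieces.
Variables (R : realType) (n : nat) (F : (set 'rV[R]_n)^nat) (t : R).
Hypothesis t0 : 0 <= t.
Hypothesis F_sum : (\sum_(0 <= i <oo) ediam_pow t (F i) <= 1)%E.

(** Markov's inequality: a piece of diameter above [r] contributes at least [r ^ t] to a sum bounded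
    by 1. *)
Lemma count_large_pieces (r : R) (N : nat) : 0 < r ->
  (\sum_(i < N) `[< r%:E < ediam (F i) >]%E)%N%:R <= r `^ (- t).
Proof.
move=> r0.
have rt0 : 0 < r `^ t by rewrite powR_gt0.
rewrite powRN -[leRHS]mul1r ler_pdivlMr// -lee_fin natr_sum mulr_suml.
apply: le_trans F_sum; apply: le_trans (nneseries_lim_ge N _); last first.
  by move=> i _ _; exact: ediam_pow_ge0.
rewrite big_mkord -sumEFin; apply: lee_sum => i _.
case: asboolP => [ri|_]; last by rewrite mul0r ediam_pow_ge0.
rewrite mul1r /ediam_pow; case: eqP => [F0|_].
  move: ri; rewrite F0 (_ : ediam _ = -oo%E)//; apply/eqP; rewrite -leeNy_eq.
  by apply: ge_ereal_sup => _ [[x y] [[]]].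
rewrite -poweR_EFin gt0_ler_poweR// ?in_itv/= ?leey ?andbT ?lee_fin ?(ltW r0)//.
  by apply: le_trans (ltW ri); rewrite lee_fin ltW.
exact: ltW.
Qed.

Variables (l0 : nat) (delta : nat -> R).

(* The second alternative assigns a scale to the pieces of diameter 0 as well, at
   the cost of one additional piece per scale. *)
Definition at_scale l i := (ediam (F i) <= (delta l)%:E)%E /\
  ((delta l.+1)%:E < ediam (F i) \/ l = (l0 + i)%N)%E.

Lemma at_scale_exists i : (ediam (F i) <= (delta l0)%:E)%E ->
  exists2 l, (l0 <= l)%N & at_scale l i.
Proof.
move=> hi; have [[k]|none] := pselect (exists k, (delta (l0 + k)%N)%:E < ediam (F i))%E; last first.
  exists (l0 + i)%N; first exact: leq_addr.
  by split; [rewrite leNgt; apply/negP => h; apply: none; exists i|right].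
(* The induction descends to the first threshold lying below the diameter. *)
elim: k => [|k IH]; first by rewrite addn0 ltNge hi.
have [lt _|le h] := ltP (delta (l0 + k)%N)%:E (ediam (F i)); first exact: IH.
exists (l0 + k)%N; first exact: leq_addr.
by split => //; left; rewrite -addnS.
Qed.

Lemma count_at_scale l N : 0 < delta l.+1 ->
  (\sum_(i < N) `[< at_scale l i >])%N%:R <= (delta l.+1) `^ (- t) + 1.
Proof.
move=> d0; apply: le_trans (lerD (count_large_pieces N d0) (lexx _)).
rewrite natr1 ler_nat -addn1.
apply: (@leq_trans (\sum_(i < N) `[< (delta l.+1)%:E < ediam (F i) >]%E + \sum_(i < N) (l == l0 + i))%N).
  rewrite -big_split /=; apply: leq_sum => i _; case: asboolP => // -[_ [h|->]].
    by case: asboolP.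
  by rewrite eqxx addn1.
rewrite leq_add2l; case: (ltnP (l - l0) N) => hN.
  rewrite (bigD1 (Ordinal hN))//= big1 ?addn0 ?leq_b1// => i ne.
  apply/eqP; rewrite eqb0; apply: contra ne => /eqP e; apply/eqP/val_inj => /=.
  by rewrite e addKn.
rewrite big1// => i _; apply/eqP; rewrite eqb0; apply/eqP => e.
by have := ltn_ord i; rewrite ltnNge (leq_trans hN)// e addKn.
Qed.

End Pieces.

(** * Labelling lines by the pieces of one scale *)

Section ScaleCount.
Variables (R : realType) (n : nat) (X : set 'rV[R]_n) (F : (set 'rV[R]_n)^nat).
Variables (j : 'I_n) (sg : bool) (q : nat) (z : int).
Variables (d : nat) (e_ : 'I_d -> 'rV[R]_n) (P : 'I_d -> 'I_n -> R).
Variables (u s0 B : nat) (I : nat -> Prop) (T : 'I_d -> nat -> bool) (rho : R).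
Let c := (96 * u ^ 2)%N.
Let K := (16 * c ^ 2)%N.
Let M := (8 * u * s0)%N.
Let w k := slope j q (e_ k).
Hypotheses (u0 : (0 < u)%N) (d0 : (0 < d)%N) (Ks0 : (8 * K <= s0)%N).
Hypothesis e_class : forall k, esphere (e_ k) /\ segment_class X (j, sg, q, z) (e_ k).
Hypothesis height : forall k th, 0 <= th <= 1 ->
  q.+1%:R * (P k j + th * w k j) - z%:~R = th.
Hypothesis I_small : forall i, I i -> (ediam (F i) <= (M%:R^-1)%:E)%E.
Hypothesis I_count : forall N, (\sum_(i < N) `[< I i >] <= B)%N.
Hypothesis T_dense : forall k, (M <= u * \sum_(m < M) T k m)%N.
Hypothesis T_piece : forall k m, T k m -> (m < M)%N /\ exists th i,
  [/\ m%:R / M%:R <= th <= m.+1%:R / M%:R, I i & F i (\row_l (P k l + th * w k l))].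
Hypothesis sep : forall k k', (forall l, `|w k l - w k' l| <= rho) -> k = k'.
Hypothesis rho_big : 72 * (64 * u * K)%:R ^+ 3 / M%:R <= rho.

(** An instance of [kakeya_count] in which the label of line k at height m is a piece met by the
    line between heights m / M and (m + 1) / M. *)
Lemma scale_count :
  (d ^ 4 * M ^ 7 <= (c * K ^ 4) ^ 4 * (2 * u * (2 * q + 5) * B.+1) ^ 7)%N.
Proof.
have K0 : (0 < K)%N by rewrite !(muln_gt0, expn_gt0) u0.
have M0 : (0 < M)%N.
  by rewrite /M !muln_gt0 u0 /=; apply: leq_trans Ks0; rewrite muln_gt0 K0.
have MR : 0 < M%:R :> R by rewrite ltr0n.
have /choice[idx hidx] : forall p : 'I_d * nat, exists i, T p.1 p.2 ->
    exists th, [/\ p.2%:R / M%:R <= th <= p.2.+1%:R / M%:R, I i &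
      F i (\row_l (P p.1 l + th * w p.1 l))].
  move=> [k m] /=; case: (boolP (T k m)) => [/T_piece[_ [th [i h]]]|_]; last by exists 0%N.
  by exists i => _; exists th.
(* Only finitely many pieces serve as labels, so a bound on their indices makes the label type
   finite. *)
pose N := (\max_(k < d) \max_(m < M) idx (k, nat_of_ord m)).+1.
have idxN k m : T k m -> (idx (k, m) < N)%N.
  move=> /T_piece[mM _]; rewrite ltnS.
  apply: leq_trans (leq_bigmax k); exact: (leq_bigmax (Ordinal mM)).
pose J0 := {i : 'I_N | `[< I i >]}.
(* [None] is a junk label, for the heights outside [T k]. *)
pose f (k : 'I_d) m : option J0 :=
  if insub (idx (k, m)) is Some i then insub (i : 'I_N) else None.
have fE k m : T k m -> exists2 y : J0, f k m = Some y & idx (k, m) = nat_of_ord (val y).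
  move=> Tkm; have [th [_ Ii _]] := hidx (k, m) Tkm.
  have Ii' : `[< I (Ordinal (idxN _ _ Tkm)) >] by apply/asboolP.
  exists (exist _ (Ordinal (idxN _ _ Tkm)) Ii') => //.
  by rewrite /f (insubT (fun i => i < N)%N (idxN _ _ Tkm)) (insubT (fun i : 'I_N => `[< I i >]) Ii').
have cardJ : #|{: option J0}| = (\sum_(i < N) `[< I i >]).+1.
  by rewrite card_option card_sig -card_pred_sum cardsE.
have pos k m : T k m -> exists th, [/\ 0 <= th <= 1, `|th - m%:R / M%:R| <= M%:R^-1,
    m%:R / M%:R <= th <= m.+1%:R / M%:R &
    F (idx (k, m)) (\row_l (P k l + th * w k l))].
  move=> Tkm; have [th [/andP[h1 h2] Ii Fi]] := hidx (k, m) Tkm.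
  have [mM _] := T_piece Tkm; exists th; split => //.
  - apply/andP; split; first by apply: le_trans h1; rewrite divr_ge0.
    by rewrite (le_trans h2)// ler_pdivrMr// mul1r ler_nat.
  - rewrite ger0_norm ?subr_ge0// lerBlDr (le_trans h2)// -natr1 mulrDl mul1r.
    by rewrite addrC.
  - by rewrite h1.
have Ismall k m : T k m -> (ediam (F (idx (k, m))) <= (M%:R^-1)%:E)%E.
  by move=> Tkm; have [th [_ Ii _]] := hidx (k, m) Tkm; exact: I_small.
have MV0 : 0 <= M%:R^-1 :> R by rewrite invr_ge0.
have w1 k l : `|w k l| <= 1.
  by have [h1 h2] := e_class k; exact: slope_le1 h1 h2.
have fib y : (#|[set m : 'I_M | [exists k, T k m && (f k m == y)]]%SET| <= 2 * q + 5)%N.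
  (* Two points of a piece differ in height by at most (q + 1) / M, and rounding down to multiples
     of 1 / M adds one step: the indices differ by at most q + 2. *)
  rewrite (_ : 2 * q + 5 = 2 * q.+2 + 1)%N; last by lia.
  apply: card_clustered => m m'; rewrite !inE.
  move=> /existsP[k /andP[Tkm /eqP fkm]] /existsP[k' /andP[Tkm' /eqP fkm']].
  have [y1 e1 i1] := fE _ _ Tkm; have [y2 e2 i2] := fE _ _ Tkm'.
  have ee : idx (k, nat_of_ord m) = idx (k', nat_of_ord m').
    by rewrite i1 i2; move: e1 e2; rewrite fkm fkm' => -> [->].
  have [th [th01 _ /andP[h1 h2] Fi]] := pos _ _ Tkm.
  have [th' [th01' _ /andP[h1' h2'] Fi']] := pos _ _ Tkm'.
  rewrite ee in Fi; have := enorm_le_ediam (Ismall _ _ Tkm') Fi Fi'.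
  move=> /(le_trans (coord_le_enorm _ j)); rewrite !mxE => hd.
  have : th - th' <= q.+1%:R / M%:R.
    rewrite -(height k th01) -(height k' th01').
    rewrite (_ : _ - _ = q.+1%:R * ((P k j + th * w k j) - (P k' j + th' * w k' j))); last by ring.
    by rewrite ler_wpM2l// (le_trans (ler_norm _)).
  rewrite lerBlDl => hth; have := le_trans h1 (le_trans hth (lerD h2' (lexx _))).
  by rewrite -mulrDl ler_pM2r ?invr_gt0// -natrD ler_nat addSn -addnS.
have close k k' m l : T k m -> T k' m -> f k m = f k' m ->
    `|(P k l + m%:R / M%:R * w k l) - (P k' l + m%:R / M%:R * w k' l)| <= 3 / M%:R.
  move=> Tk Tk' ff; have [y1 e1 i1] := fE _ _ Tk; have [y2 e2 i2] := fE _ _ Tk'.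
  have ee : idx (k, m) = idx (k', m).
    by rewrite i1 i2; move: e1 e2; rewrite ff => -> [->].
  have [th [_ h1 _ Fi]] := pos _ _ Tk; have [th' [_ h1' _ Fi']] := pos _ _ Tk'.
  rewrite ee in Fi; have := enorm_le_ediam (Ismall _ _ Tk') Fi Fi'.
  move=> /(le_trans (coord_le_enorm _ l)); rewrite !mxE => hd.
  (* Of the error 3 / M, one part is the diameter of the piece; the other two come from moving each
     point to height m / M along slopes of size at most 1. *)
  rewrite (_ : _ - _ = ((P k l + th * w k l) - (P k' l + th' * w k' l)) -
     (th - m%:R / M%:R) * w k l + (th' - m%:R / M%:R) * w k' l); last by ring.
  have b1 : `|(th - m%:R / M%:R) * w k l| <= M%:R^-1 by rewrite normrM -[leRHS]mulr1 ler_pM.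
  have b2 : `|(th' - m%:R / M%:R) * w k' l| <= M%:R^-1 by rewrite normrM -[leRHS]mulr1 ler_pM.
  rewrite (le_trans (ler_normD _ _))//.
  have -> : 3 / M%:R = M%:R^-1 + M%:R^-1 + M%:R^-1 :> R by ring.
  by rewrite lerD// (le_trans (ler_normB _ _))// lerD.
have := @kakeya_count R n 'I_d {: option J0} P w f T u s0 (2 * q + 5) rho u0.
rewrite card_ord => /(_ d0 Ks0) h.
have {}h := h _ fib close w1 sep rho_big.
apply: leq_trans (h _) _; first by move=> k; rewrite card_pred_sum.
rewrite leq_mul2l; apply/orP; right; rewrite leq_exp2r// leq_mul2l; apply/orP; right.
by rewrite cardJ ltnS.
Qed.

End ScaleCount.

(* What remains of the constants in [scale_count] once the powers of u are
   compared. *)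
Definition scale_bound (R : realType) (q L : nat) (t : R) : R :=
  (96 * (16 * 96 ^+ 2) ^+ 4) ^+ 4 * (2 * (2 * q + 5)%:R * (2 `^ (L%:R * t) + 2)) ^+ 7.

Lemma scale_bound_ge0 (R : realType) (q L : nat) (t : R) : 0 <= scale_bound q L t.
Proof.
apply: mulr_ge0; apply: exprn_ge0; apply: mulr_ge0.
- exact: ler0n.
- by apply: exprn_ge0; apply: mulr_ge0; [exact: ler0n|apply: exprn_ge0; exact: ler0n].
- by apply: mulr_ge0; exact: ler0n.
- by apply: addr_ge0; [exact: powR_ge0|exact: ler0n].
Qed.

(** Comparison of powers of u. The left side has exponent 4 ((L - 16) s - 1) + 7 L. The right side
    has 79 + 7 L t, with 72 from the loss in [common_heights] and 7 from the factor u. In [hL], 84 =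
    4 + 79 + 1 leaves one power of u to spare. *)
Lemma scale_upper_bound (R : realType) (s t : R) (q L u d B : nat) :
  0 <= t -> 64 * s + 84 <= L%:R * (4 * s + 7 - 7 * t) -> (0 < u)%N ->
  u%:R `^ ((L%:R - 16) * s - 1) <= d%:R ->
  B%:R <= 2 `^ (L%:R * t) * u%:R `^ (L%:R * t) + 1 ->
  (d ^ 4 * (u ^ L) ^ 7 <= (96 * u ^ 2 * (16 * (96 * u ^ 2) ^ 2) ^ 4) ^ 4 *
    (2 * u * (2 * q + 5) * B.+1) ^ 7)%N ->
  u%:R <= scale_bound q L t.
Proof.
move=> t0 hL u0 hd hB; rewrite -(ler_nat R).
set V : R := u%:R in hd hB *.
have V1 : 1 <= V by rewrite ler1n.
have V0 : 0 < V by rewrite (lt_le_trans ltr01).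
have Vn m : V ^+ m = V `^ m%:R by rewrite powR_mulrn ?ltW.
have Vpos x : 0 < V `^ x by rewrite powR_gt0.
have VX x m : (V `^ x) ^+ m = V `^ (x * m%:R) by rewrite powRrM powR_mulrn// powR_ge0.
have VD x y : V `^ (x + y) = V `^ x * V `^ y by rewrite powRD// (gt_eqF V0) /= implybT.
rewrite !(natrM, natrX) -/V => h.
have hB1 : B.+1%:R <= (2 `^ (L%:R * t) + 2) * V `^ (L%:R * t).
  have : 1 <= V `^ (L%:R * t) by rewrite -[leLHS](powRr0 V) ler_powR// mulr_ge0.
  by rewrite -natr1; lra.
have C0 : 0 <= 2 `^ (L%:R * t) + 2 :> R by rewrite addr_ge0// powR_ge0.
have {}h : V `^ (((L%:R - 16) * s - 1) * 4 + L%:R * 7) <=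
    scale_bound q L t * V `^ (79 + L%:R * t * 7).
  apply: (@le_trans _ _ (d%:R ^+ 4 * (V ^+ L) ^+ 7)).
    rewrite VD Vn VX; apply: ler_pM; [exact/ltW|exact/ltW| |exact: lexx].
    by rewrite -VX lerXn2r ?nnegrE// ltW.
  apply: le_trans h _.
  have -> : scale_bound q L t * V `^ (79 + L%:R * t * 7) =
      (96 * (16 * 96 ^+ 2) ^+ 4) ^+ 4 * V ^+ 72 * (2 * V * (2 * q + 5)%:R *
       ((2 `^ (L%:R * t) + 2) * V `^ (L%:R * t))) ^+ 7.
    rewrite VD -VX -Vn /scale_bound.
    move: (_ `^ _) (_ `^ _) => x y; ring.
  apply: ler_pM.
  - by rewrite !(exprn_ge0, mulr_ge0)// ltW.
  - by rewrite !(exprn_ge0, mulr_ge0)// ltW.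
  - by rewrite le_eqVlt; apply/orP; left; apply/eqP; ring.
  - have p0 : 0 <= 2 * V * (2 * q + 5)%:R by rewrite !mulr_ge0// ltW.
    rewrite lerXn2r ?nnegrE//; first exact: mulr_ge0.
      by rewrite !mulr_ge0// ltW.
    exact: ler_wpM2l.
have -> : V = V `^ 1 by rewrite powRr1// ltW.
have : V `^ (1 + (79 + L%:R * t * 7)) <= scale_bound q L t * V `^ (79 + L%:R * t * 7).
  by apply: le_trans h; rewrite ler_powR//; lra.
by rewrite VD ler_pM2r.
Qed.

(** * Directions caught at one scale and their premeasure *)

Definition scale_diam (R : realType) (L l : nat) : R := ((2 ^ l) ^ L)%:R^-1.

Section WellCovered.
Variables (R : realType) (n : nat) (X : set 'rV[R]_n) (F : (set 'rV[R]_n)^nat).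
Variables (j : 'I_n) (sg : bool) (q : nat) (z : int).

Definition well_covered (I : nat -> Prop) (M u : nat) : set 'rV[R]_n :=
  [set e | [/\ esphere e, segment_class X (j, sg, q, z) e &
    exists (P : 'I_n -> R) (T : nat -> bool),
    [/\ forall th, 0 <= th <= 1 -> q.+1%:R * (P j + th * slope j q e j) - z%:~R = th,
        forall m, T m -> (m < M)%N /\ exists th i,
          [/\ m%:R / M%:R <= th <= m.+1%:R / M%:R, I i &
              F i (\row_l (P l + th * slope j q e l))] &
        (M <= u * \sum_(m < M) T m)%N]]].

(** Each point of the line over a height in [0, 1) lies in a piece of some scale, so [dense_scale]
    finds a scale that occupies a proportion 2^-l of the heights. *)
Lemma well_covered_exists (L l0 : nat) e : (2 <= l0)%N ->
  X `<=` \bigcup_i F i ->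
  (forall i, ediam (F i) <= (scale_diam R L l0)%:E)%E ->
  esphere e -> segment_class X (j, sg, q, z) e ->
  exists k, well_covered (at_scale F l0 (@scale_diam R L) (l0 + k)%N)
    ((2 ^ (l0 + k)) ^ L) (2 ^ (l0 + k)) e.
Proof.
move=> l2 XF Fd se ce; have [P hP] := segment_class_line ce.
pose Mx l := ((2 ^ l) ^ L)%N.
have M0 l : (0 < Mx l)%N by rewrite !expn_gt0.
pose Q l m := (m < Mx l)%N /\ exists th i,
          [/\ m%:R / (Mx l)%:R <= th <= m.+1%:R / (Mx l)%:R,
              at_scale F l0 (@scale_diam R L) l i &
              F i (\row_l (P l + th * slope j q e l))].
have [|l ll dense] := @dense_scale R l0 Mx (fun l m => `[< Q l m >]) l2 M0.
  move=> th /andP[th0 th1].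
  have [|Xth _] := hP th; first by rewrite th0 ltW.
  have [i _ Fi] := XF _ Xth.
  have [l ll Ii] := @at_scale_exists R n F l0 (@scale_diam R L) i (Fd i).
  have MR : 0 < (Mx l)%:R :> R by rewrite ltr0n.
  have thM : 0 <= th * (Mx l)%:R by rewrite mulr_ge0.
  have /andP[t1 t2] := truncn_itv thM.
  have mM : (Num.trunc (th * (Mx l)%:R) < Mx l)%N.
    by rewrite truncn_lt_nat// -[ltRHS]mul1r ltr_pM2r.
  have itv : (Num.trunc (th * (Mx l)%:R))%:R / (Mx l)%:R <= th <=
      (Num.trunc (th * (Mx l)%:R)).+1%:R / (Mx l)%:R.
    by rewrite ler_pdivrMr// t1 ler_pdivlMr// ltW.
  exists l, (Num.trunc (th * (Mx l)%:R)); split => //; apply/asboolP; split=> //.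
  by exists th, i.
exists (l - l0)%N; rewrite subnKC//; split => //.
exists P, (fun m => `[< Q l m >]); split => // [th th01|m /asboolP//].
by have [] := hP th th01.
Qed.

End WellCovered.

Lemma natr_pieces_const (R : realType) (u : nat) :
  (16 * (96 * u ^ 2) ^ 2)%:R = 16 * (96 * u%:R ^+ 2) ^+ 2 :> R.
Proof. by rewrite !(natrM, natrX). Qed.

Section ScaleCover.
Variables (R : realType) (n : nat) (X : set 'rV[R]_n) (F : (set 'rV[R]_n)^nat).
Variables (j : 'I_n) (sg : bool) (q : nat) (z : int) (s t delta : R) (L l0 l : nat).

Let Cq : R := n%:R * (q.+1%:R + n%:R * q.+1%:R ^+ 4).
(** The three summands are the lower bounds on u needed for [Ks0], for [rho_le_r] and for
    contradicting [scale_upper_bound]. *)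
Definition scale_threshold : R :=
  64 * 16 * 96 ^+ 2 + 2 * Cq * (72 * (64 * 16 * 96 ^+ 2) ^+ 3) + scale_bound q L t.

Let u := (2 ^ l)%N.
Let M := (u ^ L)%N.
Let c := (96 * u ^ 2)%N.
Let K := (16 * c ^ 2)%N.
Let s0 := (2 ^ (l * (L - 1) - 3))%N.
Let rho : R := 72 * (64 * u * K)%:R ^+ 3 / M%:R.
(** Since [64 * u * K] has order u^5, [rho] has order u^(15 - L); one more power of u absorbs the
    constants. *)
Let r : R := u%:R `^ (16 - L%:R).

Hypotheses (s_ge0 : 0 <= s) (t_ge0 : 0 <= t) (L17 : (17 <= L)%N) (l2 : (2 <= l)%N).
Hypothesis hL : 64 * s + 84 <= L%:R * (4 * s + 7 - 7 * t).
Hypothesis u_large : scale_threshold < u%:R.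
Hypothesis u_delta : delta^-1 <= u%:R.
Hypothesis delta0 : 0 < delta.
Hypothesis F_sum : (\sum_(0 <= i <oo) ediam_pow t (F i) <= 1)%E.

Let V0 : 0 < u%:R :> R. Proof. by rewrite ltr0n expn_gt0. Qed.
Let V1 : 1 <= u%:R :> R. Proof. by rewrite ler1n expn_gt0. Qed.
Let Vn m : u%:R ^+ m = u%:R `^ m%:R :> R. Proof. by rewrite powR_mulrn ?ltW. Qed.
Let VD x y : u%:R `^ (x + y) = u%:R `^ x * u%:R `^ y :> R.
Proof. by rewrite powRD// (gt_eqF V0)/= implybT. Qed.
Let Cq0 : 0 <= Cq. Proof. by rewrite /Cq mulr_ge0// addr_ge0// mulr_ge0. Qed.
Let sb0 : 0 <= scale_bound q L t :> R.
Proof. exact: scale_bound_ge0. Qed.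

Let MuS : M = (8 * u * s0)%N.
Proof.
rewrite /M /u /s0 -expnM (_ : 8 = 2 ^ 3)%N// -!expnD; congr (2 ^ _)%N.
have h : (2 * 16 <= l * (L - 1))%N by apply: leq_mul => //; rewrite leq_subRL ?(leq_trans _ L17).
have -> : (l * L = l + l * (L - 1))%N.
  by rewrite -mulnS subn1 prednK// (leq_trans _ L17).
by rewrite addnAC subnKC ?(leq_trans _ h)// addnC.
Qed.

Let threshold_parts :
  [/\ 64 * 16 * 96 ^+ 2 <= u%:R :> R,
      2 * Cq * (72 * (64 * 16 * 96 ^+ 2) ^+ 3) <= u%:R &
      scale_bound q L t < u%:R].
Proof.
move: u_large sb0 Cq0; rewrite /scale_threshold.
have a0 : 0 <= 64 * 16 * 96 ^+ 2 :> R by rewrite !mulr_ge0// exprn_ge0.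
move: (64 * 16 * 96 ^+ 2 : R) a0 => a a0 h b0 c0.
have : 0 <= 2 * Cq * (72 * a ^+ 3) by rewrite !mulr_ge0// exprn_ge0.
by move: h; move: (2 * Cq * _) => y; split; lra.
Qed.

Let Ks0 : (8 * K <= s0)%N.
Proof.
rewrite -(ler_nat R) -(@ler_pM2l _ (8 * u)%:R); last by rewrite ltr0n muln_gt0 expn_gt0.
rewrite -!natrM -MuS (natrM R (8 * u)) (natrM R 8 u) (natrM R 8 K) natr_pieces_const /M (natrX _ u).
have [+ _ _] := threshold_parts; move: (u%:R : R) V1 => v v1 hv.
rewrite (_ : 8 * v * (8 * (16 * (96 * v ^+ 2) ^+ 2)) = 64 * 16 * 96 ^+ 2 * v ^+ 5); last by ring.
apply: (@le_trans _ _ (v ^+ 6)).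
  by rewrite exprS ler_wpM2r// exprn_ge0// (le_trans ler01).
by apply: ler_weXn2l => //; apply: leq_trans L17.
Qed.

Lemma rho_le_r : Cq * (rho + rho) <= r.
Proof.
have MR : 0 < M%:R :> R by rewrite ltr0n !expn_gt0.
rewrite /r /rho VD powRN -!Vn -(natrX _ u L) -/M -mulrDl mulrA.
rewrite ler_pM2r ?invr_gt0//.
rewrite (natrM R (64 * u)) (natrM R 64 u) natr_pieces_const.
have [_ + _] := threshold_parts; move: (u%:R : R) V1 => v v1 hv.
rewrite (_ : Cq * _ = 2 * Cq * (72 * (64 * 16 * 96 ^+ 2) ^+ 3) * v ^+ 15); last by ring.
by rewrite exprS ler_wpM2r// exprn_ge0// (le_trans ler01).
Qed.

(** Either at most [d] neighbourhoods of radius [rho] in slope cover the set, at cost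
    [d * r ^ s <= 1 / u], or there are [d.+1] separated directions, whose count bounds u by
    [scale_bound], against [u_large]. *)
Lemma hausdorff_pre_well_covered :
  (hausdorff_pre s delta (well_covered X F j sg q z
     (at_scale F l0 (@scale_diam R L) l) M u) <= (u%:R^-1)%:E)%E.
Proof.
set I := at_scale _ _ _ l; set A := well_covered _ _ _ _ _ _ _ _ _.
pose near (e e' : 'rV[R]_n) := forall i, `|slope j q e i - slope j q e' i| <= rho.
pose d := Num.trunc (u%:R `^ ((L%:R - 16) * s - 1) : R).
have r0 : 0 <= r by exact: powR_ge0.
have rd : r <= delta.
  have : u%:R^-1 <= delta by rewrite -[leRHS]invrK lef_pV2 ?posrE ?invr_gt0.
  apply: le_trans; rewrite -powR_inv1; last exact: ltW.
  rewrite ler_powR//.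
  have : 17 <= L%:R :> R by rewrite ler_nat.
  lra.
have drs : d%:R * r `^ s <= u%:R^-1.
  rewrite -powR_inv1; last exact: ltW.
  apply: (@le_trans _ _ (u%:R `^ ((L%:R - 16) * s - 1) * r `^ s)).
    by rewrite ler_wpM2r ?powR_ge0// truncn_le powR_ge0.
  rewrite /r -powRrM -VD ler_powR//; lra.
have [cov|nocov] := pselect (exists k, exists2 x : nat -> 'rV[R]_n, (k <= d)%N &
    A `<=` [set e | exists2 i, (i < k)%N & near (x i) e]).
  have [k [x kd Ax]] := cov.
  apply: (@le_trans _ _ (k%:R * r `^ s)%:E); last first.
    by rewrite lee_fin; apply: le_trans drs; rewrite ler_wpM2r ?powR_ge0// ler_nat.
  apply: (@hausdorff_pre_finite_cover R n s delta r k A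
     (fun i => A `&` [set e | near (x i) e])) => //.
    move=> i; apply: ge_ereal_sup => _ [[e e'] [/= [Ae he] [Ae' he']] <-].
    rewrite lee_fin; apply: le_trans rho_le_r.
    case: Ae => se ce _; case: Ae' => se' ce' _.
    apply: (slope_near se se' ce ce') => i'.
    rewrite -(subrKA (slope j q (x i) i')) (le_trans (ler_normD _ _))// lerD//.
    by rewrite distrC; exact: he.
  move=> e Ae; have [i ik hi] := Ax _ Ae.
  by exists (Ordinal ik).
exfalso.
have [|x Ax sep] := @separated_family _ near A d 0.
  move=> k x kd Ax; apply: contrapT => nex; apply: nocov; exists k, x => // e Ae.
  apply: contrapT => ne; apply: nex; exists e => // i ik he; apply: ne.
  by exists i.
have /choice[PT hPT] : forall k : 'I_d.+1, exists PT : ('I_n -> R) * (nat -> bool),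
    [/\ forall th, 0 <= th <= 1 -> q.+1%:R * (PT.1 j + th * slope j q (x k) j) - z%:~R = th,
        forall m, PT.2 m -> (m < M)%N /\ exists th i,
          [/\ m%:R / M%:R <= th <= m.+1%:R / M%:R, I i &
              F i (\row_l (PT.1 l + th * slope j q (x k) l))] &
        (M <= u * \sum_(m < M) PT.2 m)%N].
  by move=> k; have [_ _ [P [T hPT]]] := Ax k (ltn_ord k); exists (P, T).
pose B := Num.trunc (2 `^ (L%:R * t) * u%:R `^ (L%:R * t) + 1 : R).
have hB0 : 0 <= 2 `^ (L%:R * t) * u%:R `^ (L%:R * t) + 1 :> R.
  by rewrite addr_ge0// mulr_ge0// powR_ge0.
have := @scale_count R n X F j sg q z d.+1 (fun k => x k) (fun k => (PT k).1) u s0 B I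
   (fun k => (PT k).2) rho.
rewrite -MuS -/c -/K => cnt.
have {}cnt : (d.+1 ^ 4 * M ^ 7 <= (c * K ^ 4) ^ 4 * (2 * u * (2 * q + 5) * B.+1) ^ 7)%N.
  apply: cnt => //.
  - by rewrite expn_gt0.
  - by move=> k; have [se ce _] := Ax k (ltn_ord k).
  - by move=> k; have [h _ _] := hPT k.
  - by move=> i [h _].
  - move=> N; rewrite truncn_ge_nat//.
    apply: le_trans (count_at_scale t_ge0 F_sum l0 _ _) _.
      by rewrite invr_gt0 ltr0n !expn_gt0.
    (* The next threshold is (2u)^-L, which explains the factor [2 ^ (L * t)]. *)
    rewrite lerD2r /scale_diam expnS natrX natrM -/u -powR_mulrn ?mulr_ge0//.
    by rewrite -powRN -powRrM mulrNN powRM.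
  - by move=> k; have [_ _ h] := hPT k.
  - by move=> k; have [_ h _] := hPT k.
  - move=> k k' hkk; case: (ltngtP k k') => [lt|lt|/val_inj//]; exfalso.
      by apply: (sep _ _ lt _ hkk); rewrite -ltnS.
    by apply: (sep _ _ lt) => [|i]; [rewrite -ltnS|rewrite distrC].
have uL0 : 0 < (u ^ L)%:R :> R by rewrite ltr0n !expn_gt0.
have := @scale_upper_bound R s t q L u d.+1 B t_ge0 hL _ _ _ cnt.
rewrite expn_gt0 => h; have [_ _] := threshold_parts; apply/negP; rewrite -leNgt.
apply: h => //; first exact/ltW/truncnS_gt.
by rewrite truncn_le.
Qed.

End ScaleCover.

(** * The dimension bound *)

Lemma pow2_large (R : realType) (x : R) :
  exists2 l0, (2 <= l0)%N & forall l, (l0 <= l)%N -> x < (2 ^ l)%:R.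
Proof.
exists (Num.trunc x).+2 => // l hl; apply: lt_le_trans (truncnS_gt x) _.
by rewrite ler_nat; apply: leq_trans (ltnW hl) (ltnW (ltn_expl _ _)).
Qed.

Lemma hausdorff_measure_subset0 (R : realType) (n : nat) (s : R) (A B : set 'rV[R]_n) :
  A `<=` B -> hausdorff_measure s B = 0%E -> hausdorff_measure s A = 0%E.
Proof.
move=> AB B0; apply/eqP; rewrite eq_le; apply/andP; split; last first.
  by apply: le_trans (@hausdorff_pre_ge0 _ _ s 1 A) _; exact: hausdorff_pre_le_measure.
apply: ge_ereal_sup => _ [delta d0 <-]; rewrite -B0.
by apply: le_trans (hausdorff_pre_subset s delta AB) _; exact: hausdorff_pre_le_measure.
Qed.

(** Any cover of a nonempty set has a nonempty member, which costs 1 in dimension 0. *)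
Lemma hausdorff_measure0_neq0 (R : realType) (n : nat) (A : set 'rV[R]_n) :
  A !=set0 -> hausdorff_measure 0 A != 0%E.
Proof.
move=> [x Ax]; suff : (1 <= hausdorff_measure 0 A)%E.
  by apply: contraTneq => ->; rewrite -ltNge lte01.
apply: le_trans (hausdorff_pre_le_measure 0 A ltr01).
apply: le_ereal_inf_tmp => _ [F [_ AF] <-].
have [i _ Fx] := AF _ Ax.
have Fi : ediam_pow 0 (F i) = 1%E.
  rewrite /ediam_pow; case: eqP => [F0|_]; first by rewrite F0 in Fx.
  exact: poweRe0.
apply: le_trans (nneseries_lim_ge i.+1 _); last by move=> *; exact: ediam_pow_ge0.
rewrite big_nat_recr//= Fi leeDr// sume_ge0// => k _; exact: ediam_pow_ge0.
Qed.

(** Some class of directions has positive premeasure at a fixed [delta]. If [X] were null, a cover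
    by very small pieces would split this class over the scales into sets whose premeasures sum to
    less than that. *)
Lemma kakeya_hausdorff_measure_neq0 (R : realType) (n : nat)
    (Omega X : set 'rV[R]_n) (s t : R) :
  Omega `<=` @esphere R n -> kakeya_set Omega X ->
  0 <= s -> 0 <= t -> 7 * (t - 1) < 4 * s ->
  hausdorff_measure s Omega != 0%E -> hausdorff_measure t X != 0%E.
Proof.
move=> sph kak s0 t0 st Os; apply/eqP => X0.
have [cl clne0] : exists cl, hausdorff_measure s (Omega `&` segment_class X cl) != 0%E.
  apply: contrapT => none; move/negP: Os; apply; apply/eqP.
  apply: (hausdorff_measure_subset0 (kakeya_segment_class sph kak)).
  apply: hausdorff_measure_bigcup0 => cl; apply: contrapT => ne.
  by apply: none; exists cl; apply/eqP.
set A := Omega `&` _ in clne0.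
have [delta delta0 pre0] : exists2 delta, 0 < delta & (0 < hausdorff_pre s delta A)%E.
  apply: contrapT => none; move/negP: clne0; apply; rewrite eq_le; apply/andP; split.
    apply: ge_ereal_sup => _ [delta d0 <-]; rewrite leNgt; apply/negP => h.
    by apply: none; exists delta.
  by apply: le_trans (@hausdorff_pre_ge0 _ _ s 1 A) _; exact: hausdorff_pre_le_measure.
have [gamma gamma0 gammaA] : exists2 gamma : R, 0 < gamma & (gamma%:E < hausdorff_pre s delta A)%E.
  case: (hausdorff_pre s delta A) pre0 => [x| |//]; last by exists 1; rewrite ?ltry.
  by rewrite lte_fin => x0; exists (x / 2); rewrite ?lte_fin; lra.
have gap0 : 0 < 4 * s + 7 - 7 * t by lra.
(* The truncated quotient plus 1 would give [hL]; adding 17 also makes 16 - L at most -1. *)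
pose L := (Num.trunc ((64 * s + 84) / (4 * s + 7 - 7 * t)) + 17)%N.
have L17 : (17 <= L)%N by exact: leq_addl.
have hL : 64 * s + 84 <= L%:R * (4 * s + 7 - 7 * t).
  rewrite -ler_pdivrMr//; apply: (le_trans (ltW (truncnS_gt _))).
  by rewrite ler_nat /L -addn1 leq_add2l.
move: cl @A clne0 pre0 gammaA => [[[j sg] q] z] A clne0 pre0 gammaA.
pose thr : R := scale_threshold n q t L.
have [l1 l12 large1] := pow2_large thr.
have [l2 _ large2] := pow2_large delta^-1.
have [l3 _ large3] := pow2_large (2 / gamma).
(* Beyond every threshold, so that all scales [l0 + k] qualify at once. *)
pose l0 := (l1 + l2 + l3)%N.
have l0ge k : [/\ (l1 <= l0 + k)%N, (l2 <= l0 + k)%N & (l3 <= l0 + k)%N].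
  have a1 : (l1 <= l0)%N by rewrite /l0 -addnA leq_addr.
  have a2 : (l2 <= l0)%N by rewrite /l0 addnAC leq_addl.
  by split; apply: leq_trans (leq_addr k l0) => //; exact: leq_addl.
have [F [[Fd XF] F_sum]] : exists F : (set 'rV[R]_n)^nat,
    ((forall i, (ediam (F i) <= (scale_diam R L l0)%:E)%E) /\ X `<=` \bigcup_i F i) /\
    (\sum_(0 <= i <oo) ediam_pow t (F i) <= 1)%E.
  have d0 : 0 < scale_diam R L l0 by rewrite invr_gt0 ltr0n !expn_gt0.
  have : (hausdorff_pre t (scale_diam R L l0) X < 1)%E.
    by apply: le_lt_trans (hausdorff_pre_le_measure t X d0) _; rewrite X0 lte01.
  by move=> /ereal_inf_lt[_ [F hF <-] /ltW h]; exists F.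
move: gammaA; apply/negP; rewrite -leNgt.
pose W k := well_covered X F j sg q z (at_scale F l0 (@scale_diam R L) (l0 + k)%N)
  ((2 ^ (l0 + k)) ^ L) (2 ^ (l0 + k)).
have AW : A `<=` \bigcup_k W k.
  move=> e [Oe ce]; have [|k hk] := well_covered_exists (L := L) (l0 := l0) _ XF Fd (sph _ Oe) ce.
    by rewrite /l0 -addnA (leq_trans l12)// leq_addr.
  by exists k.
apply: le_trans (hausdorff_pre_subset s delta AW) _.
apply: hausdorff_pre_bigcup => [|k]; first exact: ltW.
have [h1 h2 h3] := l0ge k.
apply: (@le_lt_trans _ _ ((2 ^ (l0 + k)%N)%:R^-1)%:E).
  apply: (@hausdorff_pre_well_covered R n X F j sg q z s t delta L l0 (l0 + k)) => //.
  - exact: leq_trans l12 h1.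
  - exact: (large1 _ h1).
  - exact/ltW/(large2 _ h2).
(* From 2 / gamma < 2^l0 it follows that 1 / 2^(l0 + k) < gamma / 2^(k + 1), the share of scale
   k. *)
have hg := large3 l0 ltac:(by rewrite /l0 leq_addl).
rewrite lte_fin invf_plt ?posrE ?divr_gt0 ?ltr0n ?expn_gt0// invf_div.
rewrite expnD natrM expnS natrM mulrAC ltr_pM2r ?ltr0n ?expn_gt0//.
Qed.

Theorem theorem4 (R : realType) (n : nat) (hn : (3 <= n)%N)
    (Omega X : set 'rV[R]_n) (Omega_sphere : Omega `<=` @esphere R n)
    (Omega_neq0 : Omega !=set0) (Omega_borel : borel_set Omega)
    (X_kakeya : kakeya_set Omega X) :
  ((6 / 11 : R)%:E * hausdorff_dim Omega + 1 <= hausdorff_dim X)%E.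
Proof.
apply: le_ereal_inf_tmp => _ [t [t0 Xt] <-].
have key s : 0 <= s -> 7 * (t - 1) < 4 * s -> hausdorff_measure s Omega = 0%E.
  move=> s0 st; apply/eqP; apply: contraTT isT => /(kakeya_hausdorff_measure_neq0 Omega_sphere X_kakeya s0 t0 st).
  by rewrite Xt eqxx.
(* For t < 1 the value s = 0 would be allowed in [key], although the nonempty [Omega] has nonzero
   measure in dimension 0. *)
have t1 : 1 <= t.
  rewrite leNgt; apply/negP => t1; move: (hausdorff_measure0_neq0 Omega_neq0).
  by rewrite key ?eqxx//; lra.
have : (hausdorff_dim Omega <= (11 / 6 * (t - 1))%:E)%E.
  apply/lee_addgt0Pr => eps eps0; apply: ereal_inf_lbound.
  (* Admissible in [key] because 4 * 11 / 6 > 7; [eps] makes the inequality strict also when t =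
     1. *)
  exists (11 / 6 * (t - 1) + eps); last by rewrite EFinD.
  by split; [|apply: key]; lra.
move=> h; apply: (@le_trans _ _ ((6 / 11 : R)%:E * (11 / 6 * (t - 1))%:E + 1)%E).
  by rewrite leeD2r// lee_wpmul2l// lee_fin; lra.
by rewrite -EFinM -EFinD lee_fin; lra.
Qed.
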